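(* Let $(M,g)$ be a $4$-dimensional flat FLRW spacetime, $M=(0,\infty)\times\mathbb{R}^3$, $g=-dt^2+a(t)^2\big(dr^2+r^2d\Omega_2^2\big)$, with smooth scale factor $a:(0,\infty)\to(0,\infty)$ satisfying $\lim_{t\to0^+}a(t)=0$ and such that $a'(0):=\lim_{t\to 0^+}a'(t)$ exists in $(0,\infty]$. Assume that $(M,g)$ is future $C^0$-inextendible. Let $\psi_s:(t,r,\omega)\mapsto (T(t,r),R(t,r),\omega)$ be a natural strongly spherical change of coordinates on $\tilde M=M\setminus\big(\{r^2a'(t)^2=1\}\cup\{r=0\}\big)$ (as defined in the context). Then there is no (past) natural strongly axisymmetric $C^0$-extension of $(M,g)$ compatible with $\psi_s$.
   Context: Conventions. A $C^k$ spacetime is a connected time-oriented Lorentzian manifold $(M,g)$ with $M$ smooth and $g$ of regularity $C^k$. Timelike curves are piecewise smooth curves whose one-sided derivatives are timelike and lie in the same connected component of the lightcone. Extensions. A $C^0$-extension of $(M,g)$ is a proper (i.e. $\iota(M)\neq M_{\mathrm{ext}}$) isometric embedding $\iota:(M,g)\hookrightarrow(M_{\mathrm{ext}},g_{\mathrm{ext}})$ into a $C^0$ spacetime of the same dimension; $\partial\iota(M)$ is the topological boundary of $\iota(M)$ in $M_{\mathrm{ext}}$. The future boundary $\partial^+\iota(M)$ (resp. past boundary $\partial^-\iota(M)$) is the set of $p\in\partial\iota(M)$ for which there is a future directed timelike curve $\gamma:[0,1]\to M_{\mathrm{ext}}$ with $\gamma(1)=p$, $\gamma([0,1))\subset\iota(M)$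 (resp. $\gamma(0)=p$, $\gamma((0,1])\subset\iota(M)$). $\iota$ is a future (past) $C^0$-extension if $\partial^+\iota(M)\ne\emptyset$ ($\partial^-\iota(M)\neq\emptyset$); $(M,g)$ is future $C^0$-inextendible if it has no future $C^0$-extension. FLRW coordinates. $(t,r,\omega)\in(0,\infty)\times(0,\infty)\times\mathbb{S}^2$, where $(r,\omega)$ are spherical coordinates on $\mathbb{R}^3$ about a chosen origin; $d\Omega_2^2$ is the round metric of the unit sphere $\mathbb{S}^2$. Natural strongly spherical change of coordinates. This is a local diffeomorphism on $\tilde M$ of the form $\psi_s:(t,r,\omega)\mapsto(T(t,r),R(t,r),\omega)\in\mathbb{R}\times(0,\infty)\times\mathbb{S}^2$ in which the metric takes the strongly spherically symmetric form $$g_s=(\psi_s)_*g=-F(T,R)\,dT^2+G(T,R)\,dR^2+R^2d\Omega_2^2 .$$ ($R$ is allowed to be the timelike coordinate.) It is unique subject to an initial condition for $T$; one has $R=r\,a(t)$ and $G=\frac{1}{1-r^2a'(t)^2}$. Strongly axisymmetric form. With coordinates $(T,z,\rho,\varphi)\in\mathbb{R}\times\mathbb{R}\times(0,\infty)\times\mathbb{S}^1$, a metric has strongly axisymmetric form if it equals $$-A\,dT^2+B\,dz^2+C\,d\rho^2+\rho^2d\varphi^2+(D_1dT+D_2dz+D_3d\rho)\,d\varphi \qquad(\ast)$$ with coefficients $A,B,C,D_1,D_2,D_3$ depending only on $T,z,\rho$ (no sign assumption on coefficients, but the signature is Lorentzian). Natural strongly axisymmetric change of coordinates. Given $\psi_s$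 and a choice of polar coordinates $(\theta,\varphi)\in(0,\pi)\times\mathbb{S}^1$ on $\mathbb{S}^2$ minus two antipodal points (so $d\Omega_2^2=d\theta^2+\sin^2\theta\,d\varphi^2$), $\psi_a$ denotes a local diffeomorphism of the form $(T,R,\theta,\varphi)\mapsto(T,z(R,\theta),\rho(R,\theta),\varphi)$, with $\rho>0$, defined away from $\{G=-\tan^2\theta\}\cup\{\theta=0,\pi\}$, such that $g_a:=(\psi_a)_*(\psi_s)_*g$ has the form $(\ast)$. Natural strongly axisymmetric $C^0$-extension compatible with $\psi_s$. A $C^0$-extension $\iota:(M,g)\to(M_{\mathrm{ext}},g_{\mathrm{ext}})$ such that for every $p\in\partial\iota(M)$: (i) there exist a neighbourhood $V$ of $p$ in $M_{\mathrm{ext}}$ and a (possibly empty) two-dimensional submanifold $S\subset V$ such that $U:=V\setminus S$ satisfies $\iota^{-1}(U)\cap(M\setminus\tilde M)=\emptyset$, and there is a diffeomorphism $\psi_{\mathrm{ext},a}:U\to\psi_{\mathrm{ext},a}(U)\subseteq\mathbb{R}\times\mathbb{R}\times(0,\infty)\times\mathbb{S}^1$ such that $(\psi_{\mathrm{ext},a})_*g_{\mathrm{ext}}$ has the strongly axisymmetric form $(\ast)$ (in particular it is non-degenerate on $\psi_{\mathrm{ext},a}(U)$); (ii) $\psi_a\circ\psi_s|_{\tilde U}=\psi_{\mathrm{ext},a}\circ\iota|_{\tilde U}$, where $\psi_a$ is a natural strongly axisymmetric change of coordinates (for some choice of $(\theta,\varphi)$) and $\tilde U=\iota^{-1}(U)\setminus\big(\{G=-\tan^2\theta\}\cup\{\theta=0,\pi\}\big)$.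 *)

(* Defs.v *)
From HB Require Import structures.
From mathcomp Require Import all_boot all_order all_algebra.
From mathcomp Require Import all_classical all_reals all_analysis.

Set Implicit Arguments.
Unset Strict Implicit.
Unset Printing Implicit Defensive.

Import Order.TTheory GRing.Theory Num.Theory.
Import numFieldNormedType.Exports.

Local Open Scope classical_set_scope.
Local Open Scope ring_scope.

Section Calculus.
Context {R : realType}.

(* For open W these are the usual classes C^k(W) and C^oo(W): in finite
   dimension, f is C^(k+1) iff it is differentiable and all its directional
   derivatives are C^k. *)
Fixpoint Ck_on {V1 V2 : normedModType R} (k : nat) (W : set V1)
    (f : V1 -> V2) : Prop :=
  if k is k'.+1 then
    (forall x, W x -> differentiable f x) /\
    (forall v, Ck_on k' W (fun x => 'D_v f x))
  else forall x, W x -> {for x, continuous f}.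

Definition smooth_on {V1 V2 : normedModType R} (W : set V1)
    (f : V1 -> V2) : Prop :=
  forall k, Ck_on k W f.

Definition local_diffeo {n : nat} (W : set 'rV[R]_n)
    (f : 'rV[R]_n -> 'rV[R]_n) : Prop :=
  smooth_on W f /\
  forall x, W x -> exists (B : set 'rV[R]_n) (g : 'rV[R]_n -> 'rV[R]_n),
    [/\ open_nbhs x B, B `<=` W, open (f @` B),
        forall y, B y -> g (f y) = y & smooth_on (f @` B) g].

Definition row4 (x0 x1 x2 x3 : R) : 'rV[R]_4 :=
  \row_(i < 4) nth 0 [:: x0; x1; x2; x3] i.

Definition crd (x : 'rV[R]_4) (k : nat) : R := x 0 (inord k).

(* A bilinear form is given by its Gram matrix, tangent vectors being rows;
   the Jacobian acts on rows by right multiplication. *)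
Definition inner {n : nat} (h : 'M[R]_n) (u v : 'rV[R]_n) : R :=
  (u *m h *m v^T) 0 0.

Definition pullback {n : nat} (f : 'rV[R]_n -> 'rV[R]_n)
    (h : 'rV[R]_n -> 'M[R]_n) (x : 'rV[R]_n) : 'M[R]_n :=
  jacobian f x *m h (f x) *m (jacobian f x)^T.

Definition lorentzian (h : 'M[R]_4) : Prop :=
  h^T = h /\
  exists2 P : 'M[R]_4, P \in unitmx &
    P *m h *m P^T = diag_mx (row4 (-1) 1 1 1).

End Calculus.

(* A connected, Hausdorff, second countable smooth 4-manifold (given by an
   atlas indexed by [chart]) with a continuous Lorentzian metric and a time
   orientation, the latter given by a continuous timelike vector field.
   [metric i p] and [time i p] are the components at p in the chart i; they
   are meaningful for p in [dom i] only. *)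
Record C0_spacetime (R : realType) := C0Spacetime {
  carrier :> topologicalType;
  st_hausdorff : hausdorff_space carrier;
  st_countable : @second_countable carrier;
  st_connected : connected [set: carrier];
  chart : Type;
  dom : chart -> set carrier;
  coord : chart -> carrier -> 'rV[R]_4;
  coordV : chart -> 'rV[R]_4 -> carrier;
  dom_open : forall i, open (dom i);
  cod_open : forall i, open (coord i @` dom i);
  dom_cover : forall p, exists i, dom i p;
  coordK : forall i p, dom i p -> coordV i (coord i p) = p;
  coord_continuous : forall i p, dom i p -> {for p, continuous (coord i)};
  coordV_continuous : forall i p, dom i p ->
    {for coord i p, continuous (coordV i)};
  transition_smooth : forall i j,
    smooth_on (coord i @` (dom i `&` dom j)) (coord j \o coordV i);
  metric : chart -> carrier -> 'M[R]_4;
  metric_continuous : forall i p, dom i p -> {for p, continuous (metric i)};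
  metric_lorentzian : forall i p, dom i p -> lorentzian (metric i p);
  metric_transition : forall i j p, dom i p -> dom j p ->
    let J := jacobian (coord j \o coordV i) (coord i p) in
    metric i p = J *m metric j p *m J^T;
  time : chart -> carrier -> 'rV[R]_4;
  time_continuous : forall i p, dom i p -> {for p, continuous (time i)};
  time_timelike : forall i p, dom i p ->
    inner (metric i p) (time i p) (time i p) < 0;
  time_transition : forall i j p, dom i p -> dom j p ->
    time j p = time i p *m jacobian (coord j \o coordV i) (coord i p)
}.

Section Spacetimes.
Context {R : realType}.
Implicit Types N : C0_spacetime R.

Definition smooth_into {V : normedModType R} N (W : set V) (f : V -> N) :
    Prop :=
  (forall x, W x -> {for x, continuous f}) /\
  forall i, smooth_on (W `&` f @^-1` dom i) (coord i \o f).

Definition smooth_from N (W : set N) (f : N -> 'rV[R]_4) : Prop :=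
  forall i, smooth_on (coord i @` (W `&` dom i)) (f \o coordV i).

Definition is_diffeo N (W : set N) (f : N -> 'rV[R]_4) (g : 'rV[R]_4 -> N) :
    Prop :=
  [/\ open W, open (f @` W), forall q, W q -> g (f q) = q,
      smooth_from W f & smooth_into (f @` W) g].

(* The metric of N pulls back under f to the bilinear form h at x. *)
Definition pulls_back_to N (f : 'rV[R]_4 -> N) (x : 'rV[R]_4)
    (h : 'M[R]_4) : Prop :=
  forall i, dom i (f x) ->
    pullback (coord i \o f) (fun=> metric i (f x)) x = h.

(* v is the tangent vector at p with components v in the chart i *)
Definition future_timelike N (i : chart N) (p : N) (v : 'rV[R]_4) : Prop :=
  inner (metric i p) v v < 0 /\ inner (metric i p) v (time i p) < 0.

(* Future directed, piecewise smooth timelike curves on [s, t]. Each smooth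
   piece is the restriction of a smooth curve c defined on a larger open
   interval, so that the one-sided derivatives at its endpoints are those
   of c. *)
Inductive future_timelike_curve N (gamma : R -> N) : R -> R -> Prop :=
| ftc_piece (s t e : R) (c : R -> N) :
    s < t -> 0 < e ->
    smooth_into [set u : R | s - e < u < t + e] c ->
    (forall u, s <= u <= t -> gamma u = c u) ->
    (forall u i, s <= u <= t -> dom i (c u) ->
       future_timelike i (c u) (derive1 (coord i \o c) u)) ->
    future_timelike_curve gamma s t
| ftc_concat (s t u : R) :
    future_timelike_curve gamma s t -> future_timelike_curve gamma t u ->
    future_timelike_curve gamma s u.

Definition boundary {X : topologicalType} (A : set X) : set X :=
  closure A `\` interior A.

(* Embedded two-dimensional submanifolds, through slice charts *)
Definition surface N (S : set N) : Prop :=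
  forall q, S q -> exists (W : set N) (f : N -> 'rV[R]_4) (g : 'rV[R]_4 -> N),
    [/\ is_diffeo W f g, W q &
        forall q', W q' -> S q' <-> crd (f q') 2 = 0 /\ crd (f q') 3 = 0].

End Spacetimes.

Section FLRW.
Context {R : realType}.
Implicit Types (a : R -> R) (o : 'rV[R]_3) (Q : 'M[R]_3) (N : C0_spacetime R).

(* M = (0, oo) x R^3 as an open subset of R^4, with coordinates
   (t, x1, x2, x3), where dr^2 + r^2 dOmega^2 is the Euclidean metric of R^3;
   M is time oriented by d/dt. *)
Definition flrw_dom : set 'rV[R]_4 := [set x | 0 < crd x 0].

Definition flrw a (x : 'rV[R]_4) : 'M[R]_4 :=
  let b := a (crd x 0) ^+ 2 in diag_mx (row4 (-1) b b b).

(* Isometric smooth embeddings preserving the time orientations; that the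
   differential of iota is injective follows from the isometry condition. *)
Definition isometric_embedding a N (iota : 'rV[R]_4 -> N) : Prop :=
  [/\ smooth_into flrw_dom iota,
      forall x y, flrw_dom x -> flrw_dom y -> iota x = iota y -> x = y,
      forall B : set 'rV[R]_4, open B -> exists2 O : set N, open O &
        iota @` (B `&` flrw_dom) = O `&` iota @` flrw_dom,
      forall x, flrw_dom x -> pulls_back_to iota x (flrw a x) &
      forall x i, flrw_dom x -> dom i (iota x) ->
        future_timelike i (iota x)
          (row4 1 0 0 0 *m jacobian (coord i \o iota) x)].

Definition C0_extension a N (iota : 'rV[R]_4 -> N) : Prop :=
  isometric_embedding a iota /\ iota @` flrw_dom <> setT.

Definition future_boundary N (iota : 'rV[R]_4 -> N) (p : N) : Prop :=
  boundary (iota @` flrw_dom) p /\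
  exists gamma : R -> N,
    [/\ future_timelike_curve gamma 0 1, gamma 1 = p &
        forall s, 0 <= s < 1 -> (iota @` flrw_dom) (gamma s)].

Definition future_C0_inextendible a : Prop :=
  ~ exists (N : C0_spacetime R) (iota : 'rV[R]_4 -> N),
      C0_extension a iota /\ exists p, future_boundary iota p.

(* Spherical coordinates x = (t, r, theta, phi) of M about the origin o.
   Polar coordinates (theta, phi) on S^2 minus two antipodal points are
   given by an orthonormal basis of R^3, the rows of Q; the angle phi,
   a point of S^1, is represented by all its real lifts. *)
Definition polar_dom : set 'rV[R]_4 :=
  [set x | [/\ 0 < crd x 0, 0 < crd x 1 & 0 < crd x 2 < pi]].

Definition unit_normal (theta phi : R) : 'rV[R]_3 :=
  \row_(i < 3) nth 0 [:: sin theta * cos phi; sin theta * sin phi; cos theta] i.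

Definition spherical o Q (x : 'rV[R]_4) : 'rV[R]_4 :=
  row_mx (crd x 0)%:M
    (o + crd x 1 *: (unit_normal (crd x 2) (crd x 3) *m Q)) : 'rV[R]_(1 + 3).

(* The set M~, on which 1 - r^2 a'(t)^2 and r do not vanish *)
Definition Mtilde a o : set 'rV[R]_4 :=
  [set x | let r2 := \sum_(j < 3) ((rsubmx (x : 'rV[R]_(1 + 3)) - o) 0 j) ^+ 2 in
     [/\ 0 < crd x 0, r2 * derive1 a (crd x 0) ^+ 2 != 1 & r2 != 0]].

Definition Gcoef a (t r : R) : R := (1 - r ^+ 2 * derive1 a t ^+ 2)^-1.

(* psi_s : (t, r, theta, phi) |-> (T(t, r), Rad(t, r), theta, phi) *)
Definition psi_s (T Rad : R -> R -> R) (x : 'rV[R]_4) : 'rV[R]_4 :=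
  row4 (T (crd x 0) (crd x 1)) (Rad (crd x 0) (crd x 1)) (crd x 2) (crd x 3).

Definition strongly_spherical (F G : R -> R -> R) (y : 'rV[R]_4) : 'M[R]_4 :=
  let T := crd y 0 in let Rad := crd y 1 in
  diag_mx (row4 (- F T Rad) (G T Rad) (Rad ^+ 2)
                (Rad ^+ 2 * sin (crd y 2) ^+ 2)).

(* psi_s is only a local diffeomorphism, so the pushforward of the metric is
   defined locally, and F, G are functions of (T, R) near each point. The
   condition does not depend on the basis used for the polar coordinates. *)
Definition natural_spherical_change a o (T Rad : R -> R -> R) : Prop :=
  let W := [set x | polar_dom x /\ Mtilde a o (spherical o 1%:M x)] in
  [/\ local_diffeo W (psi_s T Rad),
      forall x, W x -> 0 < Rad (crd x 0) (crd x 1) &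
      forall y, W y -> exists F G : R -> R -> R, \forall x \near y,
        pullback (psi_s T Rad) (strongly_spherical F G) x =
        pullback (spherical o 1%:M) (flrw a) x].

(* psi_a : (T, R, theta, phi) |-> (T, z(R, theta), rho(R, theta), phi) *)
Definition psi_a (z rho : R -> R -> R) (y : 'rV[R]_4) : 'rV[R]_4 :=
  row4 (crd y 0) (z (crd y 1) (crd y 2)) (rho (crd y 1) (crd y 2)) (crd y 3).

(* The metric at y = (T, z, rho, phi); the products dT dphi, dz dphi and
   drho dphi are symmetric products, whence the factors 1/2. *)
Definition strongly_axisymmetric (A B C D1 D2 D3 : R -> R -> R -> R)
    (y : 'rV[R]_4) : 'M[R]_4 :=
  let ev (f : R -> R -> R -> R) := f (crd y 0) (crd y 1) (crd y 2) in
  let D := row4 (ev D1 / 2) (ev D2 / 2) (ev D3 / 2) 0 in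
  let e := row4 0 0 0 1 in
  diag_mx (row4 (- ev A) (ev B) (ev C) (crd y 2 ^+ 2)) + D^T *m e + e^T *m D.

(* A natural strongly axisymmetric change of coordinates psi_a for the polar
   coordinates given by Q, with domain psi_s(W), W being a set of points in
   the coordinates (t, r, theta, phi). *)
Definition natural_axisymmetric_change a o (T Rad : R -> R -> R) Q
    (W : set 'rV[R]_4) (z rho : R -> R -> R) : Prop :=
  [/\ local_diffeo (psi_s T Rad @` W) (psi_a z rho),
      forall y, (psi_s T Rad @` W) y -> 0 < rho (crd y 1) (crd y 2) &
      forall y, W y -> exists A B C D1 D2 D3 : R -> R -> R -> R,
        \forall x \near y,
        pullback (psi_a z rho \o psi_s T Rad)
          (strongly_axisymmetric A B C D1 D2 D3) x =
        pullback (spherical o Q) (flrw a) x].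

(* The manifold R x R x (0, oo) x S^1, with coordinates (T, z, rho, phi), is
   realised as an open subset of R^4 through the diffeomorphism
   (T, z, rho, phi) |-> (T, z, rho cos phi, rho sin phi). *)
Definition cylindrical_dom : set 'rV[R]_4 :=
  [set w | crd w 2 ^+ 2 + crd w 3 ^+ 2 != 0].

Definition cylindrical (y : 'rV[R]_4) : 'rV[R]_4 :=
  row4 (crd y 0) (crd y 1)
       (crd y 2 * cos (crd y 3)) (crd y 2 * sin (crd y 3)).

(* The set U~ in the coordinates (t, r, theta, phi) given by o and Q. At
   theta = pi/2 the library gives tan theta = 0, and Gcoef is nonzero on M~,
   so that no such point is removed. *)
Definition Utilde a o Q N (iota : 'rV[R]_4 -> N) (U : set N) : set 'rV[R]_4 :=
  [set x | [/\ polar_dom x, U (iota (spherical o Q x)) &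
               Gcoef a (crd x 0) (crd x 1) <> - tan (crd x 2) ^+ 2]].

Definition natural_axisymmetric_extension a o (T Rad : R -> R -> R) N
    (iota : 'rV[R]_4 -> N) : Prop :=
  C0_extension a iota /\
  forall p, boundary (iota @` flrw_dom) p ->
  exists V S : set N, [/\ open_nbhs p V, S `<=` V, surface S &
  let U := V `\` S in
  (forall x, flrw_dom x -> U (iota x) -> Mtilde a o x) /\
  exists (psi_ext : N -> 'rV[R]_4) (psi_extV : 'rV[R]_4 -> N),
  [/\ is_diffeo U psi_ext psi_extV,
      psi_ext @` U `<=` cylindrical_dom,
      exists A B C D1 D2 D3 : R -> R -> R -> R, forall y,
        0 < crd y 2 -> (psi_ext @` U) (cylindrical y) ->
        pulls_back_to (psi_extV \o cylindrical) y
          (strongly_axisymmetric A B C D1 D2 D3 y) &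
      exists (Q : 'M[R]_3) (z rho : R -> R -> R),
        let W := Utilde a o Q iota U in
        [/\ Q *m Q^T = 1%:M,
            natural_axisymmetric_change a o T Rad Q W z rho &
            forall x, W x ->
              cylindrical (psi_a z rho (psi_s T Rad x)) =
              psi_ext (iota (spherical o Q x))]]].

End FLRW.

(* Main.v *)
(** The strongly axisymmetric form forces rho = R sin theta, and eliminating A, B
    and C from the remaining components gives
      R sin theta dz/dR + cos theta G dz/dtheta = 0 with dz/dtheta <> 0.
    As z is a function of R and theta only, so is G = 1 / (1 - r^2 a'(t)^2) where
    cos theta <> 0. Since R = r a(t), this makes (a'/a)^2 locally constant in t.

    On the causal side, the boundary of iota(M) is nonempty, and near one of its
    points a straight timelike segment of a chart crosses it. Future
    inextendibility forces this segment to enter iota(M) from a past boundary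
    point. Along its preimage t increases and the spatial speed is at most 1 / a,
    so that t tends to 0 at the boundary point, for otherwise the preimage would
    converge in M. Hence every small t occurs in the given neighbourhood V of this
    point, and a dense set of them still does away from S and from the exceptional
    sets of the coordinates, all of which have empty interior. By continuity the
    derivative of (a'/a)^2 vanishes for all small t, which is impossible because
    a tends to 0 while a' has a positive limit. *)
Require Import Defs.
From mathcomp Require Import all_boot all_order all_algebra.
From mathcomp Require Import all_classical all_reals all_analysis.
From mathcomp Require Import ring lra.
(* [vector] exports another [coord]. *)
Import Defs.

Set Implicit Arguments.
Unset Strict Implicit.
Unset Printing Implicit Defensive.
Import Order.TTheory GRing.Theory Num.Theory.
Import numFieldNormedType.Exports.
Local Open Scope classical_set_scope.
Local Open Scope ring_scope.

(** * Differential calculus in R^n *)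

(** Three obstacles shape the proof. First, [T] and the coefficients of the axisymmetric form are
    unknown, so only relations free of them are usable. The phi-phi component fixes [rho]; the other
    components used pair only the t, r and theta directions, which have no phi component, so the
    mixed coefficients drop out. The resulting relation is read along a curve on which R and theta
    are fixed while t varies. Second, the constant value of (a'/a)^2 could change from one point to
    another, because the points found are only dense in time. Vanishing of the derivative is a
    closed condition and passes to all small times, which local constants by themselves do not.
    Third, the metric of the extension is merely continuous. Being timelike and future directed is
    an open condition on a point and a vector, so straight chart segments with direction close to
    the time field serve as test curves. Openness of iota(M) and differentiability of lifted curves
    come directly from the invertible Jacobian of [iota] in charts. *)

Lemma derive_comp {R : realType} {U V W : normedModType R} (f : U -> V)
    (g : V -> W) (x v : U) :
  differentiable f x -> differentiable g (f x) ->
  'D_v (g \o f) x = 'D_('D_v f x) g (f x).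
Proof.
move=> df dg; rewrite (deriveE _ df) (deriveE _ dg) deriveE.
  by rewrite (diff_comp df dg).
exact: differentiable_comp df dg.
Qed.

Lemma is_derive_comp_curve {R : realType} {V W : normedModType R} (c : R -> V)
    (g : V -> W) (t : R) (dc : V) :
  is_derive t 1 c dc -> differentiable g (c t) ->
  is_derive t 1 (g \o c) ('D_dc g (c t)).
Proof.
move=> [dct <-] dg.
have dct' : differentiable c t by exact/derivable1_diffP.
apply: DeriveDef; last exact: derive_comp dct' dg.
exact/diff_derivable/(differentiable_comp dct' dg).
Qed.

Lemma is_derive_line {R : realType} {V W : normedModType R} (f : V -> W)
    (x v : V) (t : R) :
  differentiable f (x + t *: v) ->
  is_derive t 1 (fun s => f (x + s *: v)) ('D_v f (x + t *: v)).
Proof.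
move=> df; have lt : is_derive t 1 (fun s => x + s *: v) v.
  have -> : (fun s => x + s *: v) = cst x + (fun s : R => s *: v).
    by apply/funext.
  rewrite -[X in is_derive _ _ _ X]add0r; apply: is_deriveD.
  have h : differentiable (fun s : R => s *: v) t.
    by have [] := is_diff_scalel t v.
  apply: DeriveDef; first exact: diff_derivable.
  by rewrite (deriveE _ h) (@diff_val _ _ _ _ _ _ _ (is_diff_scalel t v)) scale1r.
exact: (is_derive_comp_curve lt df).
Qed.

Lemma is_derive_entry {R : realType} {V : normedModType R} {m n : nat}
    (M : V -> 'M[R]_(m, n)) (x v : V) (dM : 'M[R]_(m, n)) i j :
  is_derive x v M dM -> is_derive x v (fun y => M y i j) (dM i j).
Proof.
move=> [dMx <-]; apply: DeriveDef; first exact: (derivable_mxP _ _ _).1.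
by rewrite derive_mx // mxE.
Qed.

(** The norm of row vectors is the sup norm; the minimisation in [critical_value] needs a
    differentiable replacement. *)
Definition sqnorm {R : realType} {n : nat} (u : 'rV[R]_n) : R :=
  \sum_(k < n) u 0 k ^+ 2.

Lemma sqnorm_ge0 {R : realType} {n : nat} (u : 'rV[R]_n) : 0 <= sqnorm u.
Proof. by apply: sumr_ge0 => k _; exact: sqr_ge0. Qed.

Lemma sqnorm_eq0 {R : realType} {n : nat} (u : 'rV[R]_n) :
  (sqnorm u == 0) = (u == 0).
Proof.
rewrite psumr_eq0; last by move=> k _; exact: sqr_ge0.
apply/idP/eqP => [/allP h|->]; last first.
  by apply/allP => k _; rewrite mxE expr0n eqxx.
apply/rowP => k; rewrite mxE; apply/eqP.
by have := h k (mem_index_enum _); rewrite /= sqrf_eq0.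
Qed.

(** Stands in for the triangle inequality. Its factor 2 is the origin of the threshold [m / 4] in
    [image_nbhs]: two terms below [m / 4] give a sum below [m]. *)
Lemma sqnormD_le {R : realType} {n : nat} (u v : 'rV[R]_n) :
  sqnorm (u + v) <= 2 * sqnorm u + 2 * sqnorm v.
Proof.
rewrite !mulr_sumr -big_split; apply: ler_sum => k _ /=; rewrite !mxE.
by have := sqr_ge0 (u 0 k - v 0 k); nra.
Qed.

Lemma sqnorm_continuous {R : realType} {n : nat} :
  continuous (@sqnorm R n).
Proof.
apply: continuous_big => [|k _ u]; first exact: add_continuous.
apply: (@continuous_comp _ _ _ (fun u : 'rV[R]_n => u 0 k) (fun r => r ^+ 2)).
  exact: matrix_normedtype.coord_continuous.
exact: exprn_continuous.
Qed.

(** * Open mapping for injective maps with invertible Jacobian *)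

Section OpenMapping.
Context {R : realType} {n : nat}.
Implicit Types (W : set 'rV[R]_n) (f : 'rV[R]_n -> 'rV[R]_n).

Lemma continuous_in_within {T U : topologicalType} (A : set T) (f : T -> U) :
  (forall x, A x -> {for x, continuous f}) -> {within A, continuous f}.
Proof.
by move=> cf; apply: continuous_in_subspaceT => x /set_mem; exact: cf.
Qed.

(* At an interior minimum of |f - y|^2 the vector f - y is orthogonal to the
   image of the differential, so it vanishes. *)
Lemma critical_value f (c y : 'rV[R]_n) (e : R) :
  0 < e -> (forall z, `|z - c| < e -> differentiable f z) ->
  jacobian f c \in unitmx ->
  (forall z, `|z - c| < e -> sqnorm (f c - y) <= sqnorm (f z - y)) -> f c = y.
Proof.
move=> e0 df Jc minc; pose v := (f c - y) *m invmx (jacobian f c).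
pose g (s : R) := sqnorm (f (c + s *: v) - y).
have [d d0 dv] : exists2 d : R, 0 < d & forall s, - d < s < d -> `|s *: v| < e.
  exists (e / (`|v| + 1)); first by rewrite divr_gt0 // ltr_wpDl.
  move=> s; rewrite -ltr_norml normrZ ltr_pdivlMr ?ltr_wpDl // => h.
  by rewrite (le_lt_trans _ h) // ler_wpM2l // lerDl.
have ing s : - d < s < d -> `|c + s *: v - c| < e.
  by move=> /dv; rewrite addrC addKr.
have dg s : - d < s < d ->
    is_derive s 1 g (\sum_(k < n) 2 * (f (c + s *: v) - y) 0 k *
                     ('D_v f (c + s *: v)) 0 k).
  move=> /ing/df/is_derive_line dfs.
  have -> : g = \sum_(k < n) (fun s => (f (c + s *: v) - y) 0 k) ^+ 2.
    by apply/funext => u; rewrite fct_sumE.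
  apply: is_derive_sum => k.
  have /(is_derive_entry 0 k) : is_derive s 1 (fun s => f (c + s *: v) - y)
      ('D_v f (c + s *: v)).
    have -> : (fun s => f (c + s *: v) - y) = (fun s => f (c + s *: v)) - cst y.
      by apply/funext.
    by rewrite -[X in is_derive _ _ _ X]subr0; exact: is_deriveB.
  by move=> /(is_deriveX 2) h; apply: is_derive_eq.
have zd : (0 : R) \in `]- d, d[%R by rewrite in_itv /= oppr_lt0 d0.
have : is_derive (0 : R) 1 g 0.
  apply: (@derive1_at_min _ g (- d) d) => //.
  - by rewrite ge0_cp // ltW.
  - by move=> t; rewrite in_itv /= => /dg [].
  - move=> t; rewrite in_itv /= => /ing/minc.
    by rewrite /g scale0r addr0.
have d0d : - d < 0 < d by rewrite oppr_lt0 d0.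
move=> [_]; rewrite (@derive_val _ _ _ _ _ _ _ (dg _ d0d)) scale0r addr0.
have dfc : differentiable f c by apply: df; rewrite subrr normr0.
rewrite deriveEjacobian // mulmxKV // => h.
apply/eqP; rewrite -subr_eq0 -sqnorm_eq0; apply/eqP.
apply: (@mulfI _ 2); first by rewrite pnatr_eq0.
rewrite mulr0 -h mulr_sumr; apply: eq_bigr => k _; ring.
Qed.

(** Minimise [|f - y|^2] over a closed ball about [x]. By injectivity and compactness [f] stays away
    from [f x] on the bounding sphere, so for [y] close to [f x] the minimum is interior, where
    [critical_value] gives [f c = y]. *)
Lemma image_nbhs W f (x : 'rV[R]_n) : open W -> W x ->
  (forall z, W z -> differentiable f z) ->
  (forall z, W z -> jacobian f z \in unitmx) ->
  {in W &, injective f} -> nbhs (f x) (f @` W).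
Proof.
move=> oW Wx df Jf injf.
have /nbhs_closedballP [e' eW] : nbhs x W by exact: open_nbhs_nbhs.
have [e e0 {}eW] : exists2 e : R, 0 < e & closed_ball x e `<=` W.
  by exists e'%:num.
have Ke : closed_ball x e = [set z | `|x - z| <= e] by rewrite closed_ballE.
have cK : compact (closed_ball x e).
  apply: bounded_closed_compact; last exact: closed_ball_closed.
  exists (`|x| + e); split; first exact: num_real.
  move=> r lr z; rewrite Ke /= => zx; apply/ltW/(le_lt_trans _ lr).
  by rewrite -(subrK x z) addrC (le_trans (ler_normD _ _)) // lerD2l distrC.
have cf z : W z -> {for z, continuous f}.
  by move=> /df; exact: differentiable_continuous.
have csq y z : W z -> {for z, continuous (fun z => sqnorm (f z - y))}.
  move=> Wz; apply: (@continuous_comp _ _ _ (fun z => f z - y) sqnorm).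
    by apply: continuousB; [exact: cf|exact: cst_continuous].
  exact: sqnorm_continuous.
pose S := closed_ball x e `&` [set z | e <= `|x - z|].
have cS : compact S.
  apply: compact_closedI => //.
  have : closed ((fun z => `|x - z|) @^-1` [set u : R | e <= u]).
    apply: preimage_closed; last exact: closed_ge.
    move=> z _; apply: continuous_comp; last exact: norm_continuous.
    by apply: continuousB; [exact: cst_continuous|].
  by [].
have [m m0 Sm] : exists2 m, 0 < m & forall z, S z -> m <= sqnorm (f z - f x).
  (* The sphere is empty when [n = 0]. *)
  have [S0|S0] := pselect (S !=set0); last first.
    by exists 1 => // z Sz; case: S0; exists z.
  have /(EVT_min_rV S0 cS) [c /set_mem [Kc xc] minc] :
      {within S, continuous (fun z => sqnorm (f z - f x))}.
    by apply: continuous_in_within => z [Kz _]; exact/csq/eW.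
  exists (sqnorm (f c - f x)); last by move=> z /mem_set; exact: minc.
  rewrite lt0r sqnorm_ge0 andbT sqnorm_eq0 subr_eq0; apply/eqP => fcx.
  have cx : c = x by apply: injf => //; apply: mem_set => //; exact: eW.
  by move: xc => /=; rewrite cx subrr normr0 leNgt e0.
have : \forall y \near f x, sqnorm (y - f x) < m / 4.
  have h : {for f x, continuous (fun y : 'rV[R]_n => sqnorm (y - f x))}.
    apply: (@continuous_comp _ _ _ (fun y : 'rV[R]_n => y - f x) sqnorm).
      by apply: continuousB; [exact: cvg_id|exact: cst_continuous].
    exact: sqnorm_continuous.
  have s0 : sqnorm (f x - f x) = 0 by apply/eqP; rewrite sqnorm_eq0 subrr.
  apply: (cvgr_lt (sqnorm (f x - f x)) h); rewrite s0.
  by rewrite divr_gt0.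
apply: filterS => y ym.
have K0 : closed_ball x e !=set0 by exists x; rewrite Ke /= subrr normr0 ltW.
have /(EVT_min_rV K0 cK) [c /set_mem Kc minc] :
    {within closed_ball x e, continuous (fun z => sqnorm (f z - y))}.
  by apply: continuous_in_within => z Kz; exact/csq/eW.
have opp z : sqnorm (- z : 'rV[R]_n) = sqnorm z.
  by apply: eq_bigr => k _; rewrite mxE sqrrN.
have xy : sqnorm (f c - y) < m / 4.
  apply: le_lt_trans ym; rewrite -[leRHS]opp opprB; apply: minc; apply: mem_set.
  by rewrite Ke /= subrr normr0 ltW.
have ce : `|x - c| < e.
  rewrite ltNge; apply/negP => ec.
  have /Sm : S c by split.
  have := sqnormD_le (f c - y) (y - f x); rewrite addrA subrK.
  by have := sqnorm_ge0 (f c - y); lra.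
exists c; first exact: eW.
have inK z : `|z - c| < e - `|x - c| -> closed_ball x e z.
  rewrite ltrBrDr => h; rewrite Ke /=; apply/ltW/(le_lt_trans _ h).
  by rewrite (le_trans (ler_distD c _ _)) // addrC lerD2r distrC.
apply: (@critical_value f c y (e - `|x - c|)).
- by rewrite subr_gt0.
- by move=> z /inK/eW/df.
- exact/Jf/eW.
- by move=> z /inK Kz; apply: minc; exact: mem_set.
Qed.

End OpenMapping.

(** * Derivatives of lifted curves, and smoothness along lines *)

Section Lifting.
Context {R : realType}.

Lemma entry_le_norm {m n : nat} (A : 'M[R]_(m, n)) i j : `|A i j| <= `|A|.
Proof.
rewrite [leRHS]/Num.norm /= mx_normrE.
exact: (le_bigmax _ (fun ij : 'I_m * 'I_n => `|A ij.1 ij.2|) (i, j)).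
Qed.

Lemma norm_le_entry {m n : nat} (A : 'M[R]_(m, n)) (e : R) :
  0 <= e -> (forall i j, `|A i j| <= e) -> `|A| <= e.
Proof.
move=> e0 h; rewrite [leLHS]/Num.norm /= mx_normrE.
by apply: bigmax_le => // -[i j] _; exact: h.
Qed.

Lemma norm_mulmx_le {m n p : nat} (A : 'M[R]_(n, p)) :
  exists2 k : R, 0 < k & forall u : 'M[R]_(m, n), `|u *m A| <= k * `|u|.
Proof.
exists (n%:R * `|A| + 1).
  by rewrite ltr_wpDl // mulr_ge0 // ler0n.
move=> u; apply: norm_le_entry => [|i j].
  by rewrite mulr_ge0 // addr_ge0 // mulr_ge0 // ler0n.
rewrite mxE (le_trans (ler_norm_sum _ _ _)) //.
apply: (@le_trans _ _ (\sum_(k < n) `|A| * `|u|)).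
  apply: ler_sum => k _; rewrite normrM mulrC.
  by apply: ler_pM => //; exact: entry_le_norm.
by rewrite sumr_const card_ord -[leLHS]mulr_natl mulrDl mul1r mulrA lerDl.
Qed.

Lemma mulmxr_continuous {m n p : nat} (A : 'M[R]_(n, p)) :
  continuous (fun u : 'M[R]_(m, n) => u *m A).
Proof.
move=> u; have [k k0 kA] := @norm_mulmx_le m n p A.
apply: ((@cvgrPdist_le _ _ _ (nbhs u) (nbhs_filter u) _ _).2) => e e0; near=> v.
rewrite -mulmxBl (le_trans (kA _)) // -ler_pdivlMl //.
near: v; apply: (cvgrPdist_le _ _).1; first exact: cvg_id.
by rewrite mulr_gt0 // invr_gt0.
Unshelve. all: by end_near. Qed.

(* Writing D for the increment of x and q for that of f o x, differentiability
   gives D - q J^-1 = o(D), whence first D = O(q) = O(h). *)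
Lemma lift_derivable {n : nat} (f : 'rV[R]_n -> 'rV[R]_n) (x : R -> 'rV[R]_n)
    (t : R) (v : 'rV[R]_n) :
  {for t, continuous x} -> differentiable f (x t) ->
  jacobian f (x t) \in unitmx -> is_derive t 1 (f \o x) v ->
  is_derive t 1 x (v *m invmx (jacobian f (x t))).
Proof.
move=> cx df Ju [dfx vE]; set J := jacobian f (x t).
have [k k0 kA] := @norm_mulmx_le 1 n n (invmx J).
pose D (h : R) := h^-1 *: (x (h *: 1 + t) - x t).
pose q (h : R) := h^-1 *: (f (x (h *: 1 + t)) - f (x t)).
have qv : q h @[h --> 0^'] --> v.
  by rewrite -vE; exact: dfx.
have xt : x (h *: 1 + t) @[h --> 0^'] --> x t.
  have c0 : {for (0 : R), continuous (fun h : R => h *: 1 + t)}.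
    apply: continuousD; last exact: cst_continuous.
    exact: scalel_continuous.
  have t0 : (0 : R) *: 1 + t = t by rewrite scale0r add0r.
  have : {for (0 : R), continuous (x \o (fun h : R => h *: 1 + t))}.
    by apply: continuous_comp => //; rewrite t0.
  by move=> /continuous_withinNx; rewrite /= t0.
have Dx e : 0 < e -> \forall h \near 0^', `|D h - q h *m invmx J| <= k * (e * `|D h|).
  move=> e0.
  have /eqaddoP/(_ e e0) : f \o shift (x t) = cst (f (x t)) + 'd f (x t) +o_ (0 : 'rV[R]_n) id.
    exact: diff_locally.
  move=> h0.
  have : \forall h \near 0^', `|f (x (h *: 1 + t)) - f (x t) - (x (h *: 1 + t) - x t) *m J|
       <= e * `|x (h *: 1 + t) - x t|.
    have dx0 : (x (h *: 1 + t) - x t) @[h --> 0^'] --> (0 : 'rV[R]_n).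
      by rewrite -(subrr (x t)); apply: cvgB => //; exact: cvg_cst.
    have H : \forall h \near 0^',
      `|(f \o shift (x t) - (cst (f (x t)) + 'd f (x t))) (x (h *: 1 + t) - x t)|
        <= e * `|x (h *: 1 + t) - x t| := dx0 _ h0.
    apply: filterS H => h /=; rewrite /J /jacobian mul_rV_lin1.
    by rewrite /= !fctE /= subrK opprD addrA.
  move=> H; near=> h.
  have h_neq0 : h != 0 by near: h; exact: nbhs_dnbhs_neq.
  have -> : D h - q h *m invmx J = - (h^-1 *: ((f (x (h *: 1 + t)) - f (x t)
      - (x (h *: 1 + t) - x t) *m J) *m invmx J)).
    rewrite mulmxBl mulmxK // scalerBr opprB /D /q -scalemxAl.
    by [].
  rewrite normrN normrZ /D normrZ.
  have : `|f (x (h *: 1 + t)) - f (x t) - (x (h *: 1 + t) - x t) *m J|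
       <= e * `|x (h *: 1 + t) - x t| by near: h.
  move=> le1; rewrite [e * _]mulrCA [k * _]mulrCA ler_wpM2l //.
  by rewrite (le_trans (kA _)) // ler_wpM2l // ltW.
have Dcvg : D h @[h --> 0^'] --> v *m invmx J.
  have qA : q h *m invmx J @[h --> 0^'] --> v *m invmx J.
    exact: (cvg_comp _ _ qv (@mulmxr_continuous 1 n n (invmx J) v)).
  have : (D h - q h *m invmx J) + q h *m invmx J @[h --> 0^'] --> (0 : 'rV[R]_n) + v *m invmx J.
    apply: cvgD => //.
    apply/cvgr0Pnorm_le => e e0.
    (* The choice of [d] gives two bounds. As [k * d <= 1 / 2], half of [|D h|] absorbs the error
       term, whence [|D h| <= C]; and [k * d * C <= e] then makes the error at most [e]. *)
    pose C := 2 * k * (`|v| + 1).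
    have C0 : 0 < C by rewrite !mulr_gt0 // ltr_wpDl.
    pose d := Num.min (e / (k * C)) (k^-1 / 2).
    have d0 : 0 < d by rewrite lt_min !divr_gt0 ?mulr_gt0 ?invr_gt0.
    near=> h.
    have h1 : `|D h - q h *m invmx J| <= k * (d * `|D h|) by near: h; exact: Dx.
    have h2 : `|q h| <= `|v| + 1.
      near: h; apply: (cvgr_norm_le _ qv).
      by rewrite ltrDl.
    have dk : k * d <= 1 / 2.
      by rewrite mulrC -ler_pdivlMr // mul1r mulrC ge_min lexx orbT.
    have dC : k * d * C <= e.
      by rewrite mulrAC -ler_pdivlMl ?mulr_gt0 // mulrC ge_min lexx.
    have h3 : `|D h| <= C.
      have := kA (q h); have := ler_normD (D h - q h *m invmx J) (q h *m invmx J).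
      rewrite subrK /C; move: h1 h2 dk.
      have := normr_ge0 (D h); have := normr_ge0 (q h); nra.
    rewrite (le_trans h1) // (le_trans _ dC) // mulrA.
    by rewrite ler_wpM2l // mulr_ge0 // ltW.
  by rewrite add0r; under eq_fun do rewrite subrK.
apply: DeriveDef; first by apply/cvg_ex; exists (v *m invmx J).
exact: cvg_lim.
Unshelve. all: by end_near. Qed.

Lemma derive_line_comp {V W : normedModType R} (f : V -> W) (x v : V)
    (h s : R) :
  'D_h (f \o (fun s => x + s *: v)) s = 'D_(h *: v) f (x + s *: v).
Proof.
rewrite /derive; set F := (X in lim (X @ _)); set G := (X in _ = lim (X @ _)).
suff -> : F = G by [].
apply/funext => u; rewrite /F /G /=.
by congr (_ *: (f _ - _)); rewrite scalerDl scalerA addrCA.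
Qed.

(** Induction on [k] works because the derivative of the composite along [h] is again a composite
    with the same line, now of ['D_(h *: v) f]. *)
Lemma Ck_on_line {V W : normedModType R} (A : set V) (B : set R)
    (f : V -> W) (x v : V) (k : nat) :
  Ck_on k A f -> (forall s, B s -> A (x + s *: v)) ->
  Ck_on k B (f \o (fun s => x + s *: v)).
Proof.
have dline s : differentiable (fun s : R => x + s *: v) s.
  apply: differentiableD; first exact: differentiable_cst.
  by have [] := is_diff_scalel s v.
move=> + BA; elim: k f => [f cf s Bs|k IHk f [df Cf]] /=.
  apply: continuous_comp; last exact/cf/BA.
  exact/differentiable_continuous/dline.
split => [s Bs|h]; first by apply: differentiable_comp; [exact: dline|exact/df/BA].
rewrite (_ : (fun _ => _) = (fun y => 'D_(h *: v) f y) \o (fun s => x + s *: v)).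
  exact: (IHk _ (Cf _)).
by apply/funext => s; rewrite derive_line_comp.
Qed.

Lemma smooth_on_line {V W : normedModType R} (A : set V) (B : set R)
    (f : V -> W) (x v : V) :
  smooth_on A f -> (forall s, B s -> A (x + s *: v)) ->
  smooth_on B (f \o (fun s => x + s *: v)).
Proof. by move=> sf BA k; exact: Ck_on_line (sf k) BA. Qed.

Lemma smooth_on_differentiable {V W : normedModType R} (A : set V) (f : V -> W)
    (x : V) :
  smooth_on A f -> A x -> differentiable f x.
Proof. by move=> /(_ 1) [+ _]; apply. Qed.

Lemma smooth_on_continuous {V W : normedModType R} (A : set V) (f : V -> W)
    (x : V) :
  smooth_on A f -> A x -> {for x, continuous f}.
Proof. by move=> /(_ 0); apply. Qed.

End Lifting.

(** * Spherical and axisymmetric coordinates *)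

Section Coordinates.
Context {R : realType}.
Implicit Types x u v : 'rV[R]_4.

Lemma sum4 (F : 'I_4 -> R) :
  \sum_i F i = F (inord 0) + F (inord 1) + F (inord 2) + F (inord 3).
Proof.
rewrite !big_ord_recl big_ord0 addr0 !addrA.
by congr (F _ + F _ + F _ + F _); apply/val_inj; rewrite /= inordK.
Qed.

Lemma forall4 (P : 'I_4 -> Prop) :
  P (inord 0) -> P (inord 1) -> P (inord 2) -> P (inord 3) -> forall i, P i.
Proof.
move=> P0 P1 P2 P3 [[|[|[|[|i]]]] lti] //.
- by have -> : Ordinal lti = inord 0; first by apply/val_inj; rewrite /= inordK.
- by have -> : Ordinal lti = inord 1; first by apply/val_inj; rewrite /= inordK.
- by have -> : Ordinal lti = inord 2; first by apply/val_inj; rewrite /= inordK.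
- by have -> : Ordinal lti = inord 3; first by apply/val_inj; rewrite /= inordK.
Qed.

Lemma crd_row4 (x0 x1 x2 x3 : R) :
  (crd (row4 x0 x1 x2 x3) 0 = x0) * (crd (row4 x0 x1 x2 x3) 1 = x1) *
  (crd (row4 x0 x1 x2 x3) 2 = x2) * (crd (row4 x0 x1 x2 x3) 3 = x3).
Proof. by rewrite /crd /row4 !mxE !inordK. Qed.

Lemma crd_inj x u : (forall k, (k < 4)%N -> crd x k = crd u k) -> x = u.
Proof. by move=> h; apply/rowP; apply: forall4; exact: h. Qed.

Lemma row4_crd x : row4 (crd x 0) (crd x 1) (crd x 2) (crd x 3) = x.
Proof. by apply: crd_inj => -[|[|[|[|k]]]] // _; rewrite crd_row4. Qed.

Lemma crdD x u k : crd (x + u) k = crd x k + crd u k.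
Proof. by rewrite /crd mxE. Qed.

Lemma crdZ (b : R) u k : crd (b *: u) k = b * crd u k.
Proof. by rewrite /crd mxE. Qed.

Lemma crd_continuous k : continuous (fun x => crd x k).
Proof. exact: matrix_normedtype.coord_continuous. Qed.

Lemma crd_differentiable k x : differentiable (fun x => crd x k) x.
Proof. exact: differentiable_coord. Qed.

Lemma is_derive_crd {V : normedModType R} (M : V -> 'rV[R]_4) (x v : V) dM k :
  is_derive x v M dM -> is_derive x v (fun y => crd (M y) k) (crd dM k).
Proof. exact: is_derive_entry. Qed.

Lemma derive_crd {V : normedModType R} (M : V -> 'rV[R]_4) (x v : V) k :
  derivable M x v -> crd ('D_v M x) k = 'D_v (fun y => crd (M y) k) x.
Proof. by move=> dM; rewrite derive_mx // /crd mxE. Qed.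

Lemma differentiable_row {V : normedModType R} {n : nat} (M : V -> 'rV[R]_n)
    (x : V) :
  (forall k, differentiable (fun y => M y 0 k) x) -> differentiable M x.
Proof.
move=> dM.
have -> : M = \sum_(k < n) (fun y => M y 0 k *: delta_mx 0 k).
  apply/funext => y; rewrite fct_sumE [LHS]matrix_sum_delta big_ord1.
  by [].
apply: differentiable_sum => k; apply: differentiableZl; exact: dM.
Qed.

Lemma inner_mulmx (h J : 'M[R]_4) u v :
  inner (J *m h *m J^T) u v = inner h (u *m J) (v *m J).
Proof. by rewrite /inner trmx_mul !mulmxA. Qed.

Lemma inner_diag (d : 'rV[R]_4) u v :
  inner (diag_mx d) u v = \sum_i d 0 i * u 0 i * v 0 i.
Proof.
rewrite /inner mxE; apply: eq_bigr => i _.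
by rewrite mul_mx_diag !mxE [d _ _ * _]mulrC.
Qed.

Lemma innerD (h k : 'M[R]_4) u v : inner (h + k) u v = inner h u v + inner k u v.
Proof. by rewrite /inner mulmxDr mulmxDl mxE. Qed.

Lemma inner_rank1 (d e u v : 'rV[R]_4) :
  inner (d^T *m e) u v = (\sum_i u 0 i * d 0 i) * (\sum_i e 0 i * v 0 i).
Proof.
rewrite /inner mulmxA -mulmxA [LHS]mxE big_ord1; congr (_ * _); rewrite mxE.
  by apply: eq_bigr => i _; rewrite mxE.
by apply: eq_bigr => i _; rewrite mxE.
Qed.

Lemma inner_strongly_axisymmetric (A B C D1 D2 D3 : R -> R -> R -> R) y u v :
  let ev (f : R -> R -> R -> R) := f (crd y 0) (crd y 1) (crd y 2) in
  inner (strongly_axisymmetric A B C D1 D2 D3 y) u v =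
  - ev A * crd u 0 * crd v 0 + ev B * crd u 1 * crd v 1
  + ev C * crd u 2 * crd v 2 + crd y 2 ^+ 2 * crd u 3 * crd v 3
  + (ev D1 * crd u 0 + ev D2 * crd u 1 + ev D3 * crd u 2) / 2 * crd v 3
  + crd u 3 * ((ev D1 * crd v 0 + ev D2 * crd v 1 + ev D3 * crd v 2) / 2).
Proof.
move=> ev; rewrite /strongly_axisymmetric !innerD inner_diag !inner_rank1 !sum4.
rewrite -![row4 _ _ _ _ 0 _]/(crd (row4 _ _ _ _) _) !crd_row4 /ev /crd.
by field.
Qed.

(** Both sides are limits of the same difference quotient, so no derivability is involved. This lets
    the components of [psi_a] be expressed through one-variable derivatives of [z] and [rho], whose
    regularity is only known through [psi_a]. *)
Lemma derive_along {V : normedModType R} (g : V -> R) (f : R -> R) (x v : V)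
    (b : R) :
  (forall h : R, g (h *: v + x) = f (h + b)) -> 'D_v g x = derive1 f b.
Proof.
move=> gf; rewrite /derive /derive1.
set F := (X in lim (X @ _)); set G := (X in _ = lim (X @ _)).
suff -> : F = G by [].
apply/funext => h; rewrite /F /G /= gf.
by have := gf 0; rewrite scale0r !add0r => ->.
Qed.

Lemma is_derive_comp_fun {V : normedModType R} (f : V -> R) (g : R -> R)
    (x v : V) (df dg : R) :
  differentiable f x -> is_derive x v f df -> is_derive (f x) 1 g dg ->
  is_derive x v (g \o f) (df * dg).
Proof.
move=> dfx [_ <-] [dgx <-].
have dgx' : differentiable g (f x) by exact/derivable1_diffP.
apply: DeriveDef; first exact: diff_derivable (differentiable_comp dfx dgx').
rewrite (derive_comp _ dfx dgx') !(deriveE _ dgx').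
by rewrite -[X in 'd g _ X]mulr1 linearZ.
Qed.

End Coordinates.

(** * The FLRW metric in polar coordinates *)

Section PolarCoordinates.
Context {R : realType}.
Implicit Types (a : R -> R) (o : 'rV[R]_3) (Q : 'M[R]_3) (x u v : 'rV[R]_4).

Lemma row3_mulE (n : 'rV[R]_3) Q k :
  (n *m Q) 0 k = n 0 (inord 0) * Q (inord 0) k + n 0 (inord 1) * Q (inord 1) k
                 + n 0 (inord 2) * Q (inord 2) k.
Proof.
rewrite mxE !big_ord_recl big_ord0 addr0 !addrA.
by congr (n _ _ * Q _ _ + n _ _ * Q _ _ + n _ _ * Q _ _);
  apply/val_inj; rewrite /= inordK.
Qed.

Definition row3 (y0 y1 y2 : R) : 'rV[R]_3 := \row_(i < 3) nth 0 [:: y0; y1; y2] i.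

Lemma row3E (y0 y1 y2 : R) :
  (row3 y0 y1 y2 0 (inord 0) = y0) * (row3 y0 y1 y2 0 (inord 1) = y1) *
  (row3 y0 y1 y2 0 (inord 2) = y2).
Proof. by rewrite /row3 !mxE !inordK. Qed.

Lemma dot3E (y z : 'rV[R]_3) :
  (y *m z^T) 0 0 = y 0 (inord 0) * z 0 (inord 0) + y 0 (inord 1) * z 0 (inord 1)
                   + y 0 (inord 2) * z 0 (inord 2).
Proof.
rewrite mxE !big_ord_recl big_ord0 addr0 !addrA.
by congr (y _ _ * _ + y _ _ * _ + y _ _ * _); rewrite ?mxE;
  do ?[congr (z _ _)]; apply/val_inj; rewrite /= inordK.
Qed.

Definition unit_normal_derive x u : 'rV[R]_3 :=
  row3 (cos (crd x 2) * cos (crd x 3) * crd u 2 - sin (crd x 2) * sin (crd x 3) * crd u 3)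
       (cos (crd x 2) * sin (crd x 3) * crd u 2 + sin (crd x 2) * cos (crd x 3) * crd u 3)
       (- sin (crd x 2) * crd u 2).

Lemma sin_crd_differentiable k x : differentiable (fun y => sin (crd y k)) x.
Proof.
apply: (differentiable_comp (crd_differentiable k x)).
exact/derivable1_diffP.
Qed.

Lemma cos_crd_differentiable k x : differentiable (fun y => cos (crd y k)) x.
Proof.
apply: (differentiable_comp (crd_differentiable k x)).
exact/derivable1_diffP.
Qed.

Lemma is_derive_crd_id k x u : is_derive x u (fun y => crd y k) (crd u k).
Proof. exact: (is_derive_crd k (is_derive_id x u)). Qed.

Lemma is_derive_sin_crd k x u :
  is_derive x u (fun y => sin (crd y k)) (crd u k * cos (crd x k)).
Proof.
exact: (is_derive_comp_fun (crd_differentiable k x) (is_derive_crd_id k x u)).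
Qed.

Lemma is_derive_cos_crd k x u :
  is_derive x u (fun y => cos (crd y k)) (crd u k * - sin (crd x k)).
Proof.
exact: (is_derive_comp_fun (crd_differentiable k x) (is_derive_crd_id k x u)).
Qed.

Lemma spherical_entry o Q x k :
  (spherical o Q x : 'rV_(1 + 3)) 0 (rshift 1 k) =
  o 0 k + crd x 1 * (sin (crd x 2) * cos (crd x 3) * Q (inord 0) k
    + sin (crd x 2) * sin (crd x 3) * Q (inord 1) k + cos (crd x 2) * Q (inord 2) k).
Proof.
rewrite /spherical row_mxEr [LHS]mxE [X in _ + X]mxE row3_mulE.
by rewrite -[unit_normal _ _]/(row3 _ _ _) !row3E.
Qed.

Lemma lshift_inord0 (i : 'I_1) : lshift 3 i = inord 0 :> 'I_4.
Proof. by apply/val_inj; rewrite /= inordK // ord1. Qed.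

Lemma crd_row_mx0 (b : R) (z : 'rV[R]_3) :
  crd (row_mx b%:M z : 'rV_(1 + 3)) 0 = b.
Proof.
rewrite /crd -(lshift_inord0 ord0).
by apply: (etrans (row_mxEl (b%:M : 'M[R]_1) z 0 ord0)); rewrite mxE eqxx mulr1n.
Qed.

Lemma spherical_crd0 o Q x : crd (spherical o Q x) 0 = crd x 0.
Proof. exact: crd_row_mx0. Qed.

Lemma spherical_differentiable o Q x : differentiable (spherical o Q) x.
Proof.
apply: differentiable_row => k.
have [j ->|j ->] := split_ordP (k : 'I_(1 + 3)).
  rewrite lshift_inord0.
  rewrite (_ : (fun _ => _) = (fun y => crd y 0)); first exact: crd_differentiable.
  by apply/funext => y; rewrite -[LHS]/(crd _ 0) spherical_crd0.
rewrite (_ : (fun _ => _) = cst (o 0 j) + (fun y => crd y 1) *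
    ((fun y => sin (crd y 2)) * (fun y => cos (crd y 3)) * cst (Q (inord 0) j)
    + (fun y => sin (crd y 2)) * (fun y => sin (crd y 3)) * cst (Q (inord 1) j)
    + (fun y => cos (crd y 2)) * cst (Q (inord 2) j))); last first.
  by apply/funext => y; rewrite spherical_entry.
have dc (b : R) : differentiable (cst b : 'rV[R]_4 -> R) x by exact: differentiable_cst.
apply: differentiableD => //; apply: differentiableM; first exact: crd_differentiable.
have ds2 := sin_crd_differentiable 2 x; have ds3 := sin_crd_differentiable 3 x.
have dc2 := cos_crd_differentiable 2 x; have dc3 := cos_crd_differentiable 3 x.
apply: differentiableD; last exact: differentiableM dc2 (dc _).
by apply: differentiableD;
  (apply: differentiableM; [exact: differentiableM|exact: dc]).
Qed.

Lemma derive_spherical o Q x u :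
  'D_u (spherical o Q) x = row_mx (crd u 0)%:M
    ((crd u 1 *: unit_normal (crd x 2) (crd x 3) + crd x 1 *: unit_normal_derive x u)
      *m Q) :> 'rV_(1 + 3).
Proof.
have dS : derivable (spherical o Q) x u.
  exact/diff_derivable/spherical_differentiable.
apply/rowP => k; rewrite derive_mx // mxE.
have [j ->|j ->] := split_ordP (k : 'I_(1 + 3)).
  rewrite row_mxEl lshift_inord0 ord1 mxE eqxx mulr1n.
  rewrite (_ : (fun _ => _) = (fun y => crd y 0)); first by case: (is_derive_crd_id 0 x u).
  by apply/funext => y; rewrite -[LHS]/(crd _ 0) spherical_crd0.
rewrite row_mxEr row3_mulE.
rewrite (_ : (fun _ => _) = cst (o 0 j) + (fun y => crd y 1) *
    ((fun y => sin (crd y 2)) * (fun y => cos (crd y 3)) * cst (Q (inord 0) j)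
    + (fun y => sin (crd y 2)) * (fun y => sin (crd y 3)) * cst (Q (inord 1) j)
    + (fun y => cos (crd y 2)) * cst (Q (inord 2) j))); last first.
  by apply/funext => y; rewrite spherical_entry.
have dc1 := is_derive_crd_id 1 x u.
have ds2 := is_derive_sin_crd 2 x u; have ds3 := is_derive_sin_crd 3 x u.
have dc2 := is_derive_cos_crd 2 x u; have dc3 := is_derive_cos_crd 3 x u.
have dq i := @is_derive_cst R _ _ (Q (inord i) j) x u.
have [_ ->] := is_deriveD (is_derive_cst (o 0 j) x u) (is_deriveM dc1
  (is_deriveD (is_deriveD (is_deriveM (is_deriveM ds2 dc3) (dq 0))
                          (is_deriveM (is_deriveM ds2 ds3) (dq 1)))
              (is_deriveM dc2 (dq 2)))).
have E (b c : R) (y z : 'rV[R]_3) l :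
    (b *: y + c *: z) 0 l = b * y 0 l + c * z 0 l by rewrite !mxE.
rewrite !E -[unit_normal _ _]/(row3 _ _ _) /unit_normal_derive !row3E.
rewrite /GRing.scale /= /cst !fctE.
ring.
Qed.

Lemma inner_flrw a x u v :
  inner (flrw a x) u v = - crd u 0 * crd v 0 + a (crd x 0) ^+ 2 *
    (rsubmx (u : 'rV_(1 + 3)) *m (rsubmx (v : 'rV_(1 + 3)))^T) 0 0.
Proof.
rewrite /flrw inner_diag sum4 /crd.
rewrite -![row4 _ _ _ _ 0 _]/(crd (row4 _ _ _ _) _) !crd_row4 dot3E !mxE.
have E k (lk : (k < 3)%N) : rshift 1 (inord k : 'I_3) = inord k.+1 :> 'I_4.
  by apply/val_inj; rewrite /= !inordK.
by rewrite !E //; ring.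
Qed.

(** The frame enters only through [Q *m Q^T], hence disappears; the mixed terms cancel by the
    Pythagorean identity, first in phi and then in theta. *)
Lemma inner_spherical a o Q x u v : Q *m Q^T = 1%:M ->
  inner (pullback (spherical o Q) (flrw a) x) u v =
  - crd u 0 * crd v 0 + a (crd x 0) ^+ 2 *
    (crd u 1 * crd v 1 + crd x 1 ^+ 2 * (crd u 2 * crd v 2)
     + crd x 1 ^+ 2 * sin (crd x 2) ^+ 2 * (crd u 3 * crd v 3)).
Proof.
move=> QQ; have dS := @spherical_differentiable o Q x.
pose N w := crd w 1 *: unit_normal (crd x 2) (crd x 3)
  + crd x 1 *: unit_normal_derive x w.
have D0 w : crd (w *m jacobian (spherical o Q) x) 0 = crd w 0.
  by rewrite -(deriveEjacobian w dS) derive_spherical crd_row_mx0.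
have DN w : rsubmx (w *m jacobian (spherical o Q) x : 'rV_(1 + 3)) = N w *m Q.
  by rewrite -(deriveEjacobian w dS) derive_spherical row_mxKr.
rewrite inner_mulmx; move: (D0 u) (D0 v) (DN u) (DN v).
move: (u *m _) (v *m _) => U V U0 V0 UN VN.
rewrite inner_flrw spherical_crd0 U0 V0 UN VN.
rewrite trmx_mul mulmxA -(mulmxA (N u)) QQ mulmx1.
congr (_ + _ * _); rewrite dot3E.
have E (b c : R) (y z : 'rV[R]_3) l :
    (b *: y + c *: z) 0 l = b * y 0 l + c * z 0 l by rewrite !mxE.
rewrite !E -[unit_normal _ _]/(row3 _ _ _) /unit_normal_derive !row3E.
have : cos (crd x 3) ^+ 2 + sin (crd x 3) ^+ 2 = 1 by rewrite cos2Dsin2.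
have : cos (crd x 2) ^+ 2 + sin (crd x 2) ^+ 2 = 1 by rewrite cos2Dsin2.
move: (cos (crd x 2)) (sin (crd x 2)) (cos (crd x 3)) (sin (crd x 3)).
move: (crd x 1) (crd u 1) (crd u 2) (crd u 3) (crd v 1) (crd v 2) (crd v 3).
move=> r u1 u2 u3 v1 v2 v3 c s c' s' cs cs'.
transitivity (((u1 * s + r * c * u2) * (v1 * s + r * c * v2)
   + r ^+ 2 * s ^+ 2 * (u3 * v3)) * (c' ^+ 2 + s' ^+ 2)
   + (u1 * c - r * s * u2) * (v1 * c - r * s * v2)); first by ring.
rewrite cs' mulr1.
transitivity ((u1 * v1 + r ^+ 2 * (u2 * v2)) * (c ^+ 2 + s ^+ 2)
   + r ^+ 2 * s ^+ 2 * (u3 * v3)); first by ring.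
by rewrite cs mulr1.
Qed.

End PolarCoordinates.

(** * Spherical and axisymmetric changes of coordinates *)

Section SymmetricCoordinates.
Context {R : realType}.
Implicit Types (a : R -> R) (o : 'rV[R]_3) (Q : 'M[R]_3) (x y u v w : 'rV[R]_4).

(* K is the coefficient G of the spherical form; the elimination uses
   (A t0 t1)^2 = (A t0^2)(A t1^2) and its analogue for B. *)
Lemma axisymmetric_elimination (A B C t0 t1 zR zt a a1 r s c : R) :
  0 < r -> 0 < a -> 0 < s -> 1 - r ^+ 2 * a1 ^+ 2 != 0 ->
  - A * t0 * t0 + B * (r * a1 * zR) * (r * a1 * zR)
    + C * (r * a1 * s) * (r * a1 * s) = -1 ->
  - A * t0 * t1 + B * (r * a1 * zR) * (a * zR)
    + C * (r * a1 * s) * (a * s) = 0 ->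
  - A * t1 * t1 + B * (a * zR) * (a * zR) + C * (a * s) * (a * s) = a ^+ 2 ->
  B * (a * zR) * zt + C * (a * s) * (r * a * c) = 0 ->
  B * zt * zt + C * (r * a * c) * (r * a * c) = a ^+ 2 * r ^+ 2 ->
  zt != 0 /\ r * a * s * zR + c * (1 - r ^+ 2 * a1 ^+ 2)^-1 * zt = 0.
Proof.
move=> r0 a0 s0 nz E00 E01 E11 E12 E22; pose K := B * zR ^+ 2 + C * s ^+ 2.
have a20 : a ^+ 2 != 0 by rewrite expf_neq0 // gt_eqF.
have R20 : r ^+ 2 * a ^+ 2 != 0 by rewrite mulf_neq0 // expf_neq0 // gt_eqF.
have KE : K * (1 - r ^+ 2 * a1 ^+ 2) = 1.
  have E0 : A * t0 ^+ 2 = 1 + K * (r * a1) ^+ 2 by rewrite /K; lra.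
  have E1 : A * t1 ^+ 2 = K * a ^+ 2 - a ^+ 2 by rewrite /K; lra.
  have E2 : A * t0 * t1 = K * (r * a1 * a) by rewrite /K; lra.
  have : (A * t0 * t1) ^+ 2 = (A * t0 ^+ 2) * (A * t1 ^+ 2) by ring.
  rewrite E0 E1 E2 => h; apply: (mulfI a20); lra.
have CK : C * (s ^+ 2 + K * c ^+ 2) = K.
  have E1 : B * zt ^+ 2 = r ^+ 2 * a ^+ 2 - C * (r * a * c) ^+ 2 by lra.
  have E2 : B * zR * zt = - (C * s * (r * a * c)).
    by apply: (@mulfI _ a); [rewrite gt_eqF|lra].
  have : (B * zR * zt) ^+ 2 = (B * zR ^+ 2) * (B * zt ^+ 2) by ring.
  have -> : B * zR ^+ 2 = K - C * s ^+ 2 by rewrite /K; ring.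
  rewrite E1 E2 => h; apply: (mulfI R20); lra.
(* The right-hand side is positive, so [B * zt] is nonzero. This yields [zt != 0] and also allows
   the final identity to be multiplied by [B * zt], after which every term is known from the metric
   components. *)
have Bz : (s ^+ 2 + K * c ^+ 2) * (B * zt ^+ 2) = r ^+ 2 * a ^+ 2 * s ^+ 2.
  have -> : B * zt ^+ 2 = r ^+ 2 * a ^+ 2 - C * (r * a * c) ^+ 2 by lra.
  transitivity (r ^+ 2 * a ^+ 2 * (s ^+ 2 + K * c ^+ 2
    - c ^+ 2 * (C * (s ^+ 2 + K * c ^+ 2)))); first by ring.
  by rewrite CK; ring.
have Bz0 : B * zt != 0.
  apply/eqP => h; have : r ^+ 2 * a ^+ 2 * s ^+ 2 = 0.
    by rewrite -Bz [zt ^+ 2]expr2 [B * _]mulrA h mul0r mulr0.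
  by apply/eqP; rewrite mulf_neq0 // expf_neq0 // gt_eqF.
split; first by apply: contraNneq Bz0 => ->; rewrite mulr0.
have -> : (1 - r ^+ 2 * a1 ^+ 2)^-1 = K.
  by apply: (mulIf nz); rewrite KE mulVf.
apply: (mulfI Bz0); rewrite mulr0.
transitivity (r * s * (B * (a * zR) * zt) + c * K * (B * zt * zt)); first by ring.
have -> : B * (a * zR) * zt = - (C * (a * s) * (r * a * c)) by lra.
have -> : B * zt * zt = r ^+ 2 * a ^+ 2 - C * (r * a * c) ^+ 2 by lra.
transitivity (c * r ^+ 2 * a ^+ 2 * (K - C * (s ^+ 2 + K * c ^+ 2))); first by ring.
by rewrite CK subrr mulr0.
Qed.

Lemma spherical_dist o Q x : Q *m Q^T = 1%:M ->
  \sum_(j < 3) ((rsubmx (spherical o Q x : 'rV_(1 + 3)) - o) 0 j) ^+ 2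
  = crd x 1 ^+ 2.
Proof.
move=> QQ; rewrite /spherical row_mxKr addrC addKr.
set n := unit_normal _ _; set b := crd x 1.
transitivity (((b *: (n *m Q)) *m (b *: (n *m Q))^T) 0 0).
  by rewrite mxE; apply: eq_bigr => j _; rewrite !mxE expr2.
rewrite linearZ /= -scalemxAl -scalemxAr scalerA trmx_mul mulmxA -(mulmxA n) QQ.
rewrite mulmx1 mxE dot3E /n -[unit_normal _ _]/(row3 _ _ _) !row3E.
rewrite -[RHS]mulr1 expr2; congr (_ * _).
have := cos2Dsin2 (crd x 2); have := cos2Dsin2 (crd x 3).
move: (cos (crd x 3)) (sin (crd x 3)) (cos (crd x 2)) (sin (crd x 2)).
move=> c' s' c s cs' cs.
transitivity (s ^+ 2 * (c' ^+ 2 + s' ^+ 2) + c ^+ 2); first by ring.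
by rewrite cs' mulr1 addrC.
Qed.

Lemma Mtilde_spherical a o Q x : Q *m Q^T = 1%:M ->
  Mtilde a o (spherical o Q x) <->
  [/\ 0 < crd x 0, crd x 1 ^+ 2 * derive1 a (crd x 0) ^+ 2 != 1 &
      crd x 1 ^+ 2 != 0].
Proof. by move=> QQ; rewrite /Mtilde /= spherical_dist // spherical_crd0. Qed.

Lemma inner_pullback (f : 'rV[R]_4 -> 'rV[R]_4) (h : 'rV[R]_4 -> 'M[R]_4) x u v :
  inner (pullback f h x) u v =
  inner (h (f x)) (u *m jacobian f x) (v *m jacobian f x).
Proof. exact: inner_mulmx. Qed.

Lemma crd_derive_const (f : 'rV[R]_4 -> R) x v :
  (forall h : R, f (h *: v + x) = f x) -> 'D_v f x = 0.
Proof.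
move=> h; rewrite (@derive_along _ _ f (cst (f x)) x v 0) // derive1E.
by rewrite derive_cst.
Qed.

Lemma derive_psi_s (T Rad : R -> R -> R) x u :
  differentiable (psi_s T Rad) x ->
  (crd ('D_u (psi_s T Rad) x) 2 = crd u 2) * (crd ('D_u (psi_s T Rad) x) 3 = crd u 3).
Proof.
move=> dp; have du : derivable (psi_s T Rad) x u by exact: diff_derivable.
rewrite !derive_crd //; split.
  rewrite (_ : (fun _ => _) = (fun y => crd y 2)).
    by case: (is_derive_crd_id 2 x u).
  by apply/funext => y; rewrite crd_row4.
rewrite (_ : (fun _ => _) = (fun y => crd y 3)).
  by case: (is_derive_crd_id 3 x u).
by apply/funext => y; rewrite crd_row4.
Qed.

(** The four axis directions reduce to one-variable derivatives by [derive_along]; linearity of the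
    differential gives the rest. *)
Lemma derive_psi_a (z rho : R -> R -> R) y w :
  differentiable (psi_a z rho) y ->
  'D_w (psi_a z rho) y = row4 (crd w 0)
    (crd w 1 * derive1 (z^~ (crd y 2)) (crd y 1) + crd w 2 * derive1 (z (crd y 1)) (crd y 2))
    (crd w 1 * derive1 (rho^~ (crd y 2)) (crd y 1) + crd w 2 * derive1 (rho (crd y 1)) (crd y 2))
    (crd w 3).
Proof.
move=> dp.
have De v k (f : R -> R) (b : R) :
    (forall h : R, crd (psi_a z rho (h *: v + y)) k = f (h + b)) ->
    crd ('D_v (psi_a z rho) y) k = derive1 f b.
  move=> hf; rewrite derive_crd; first exact: derive_along.
  exact: diff_derivable.
have idE (b : R) : derive1 (id : R -> R) b = 1 by exact: derive1_id.
have cstE (c b : R) : derive1 (cst c : R -> R) b = 0 by exact: derive1_cst.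
have split_w : w = crd w 0 *: row4 1 0 0 0 + crd w 1 *: row4 0 1 0 0
            + crd w 2 *: row4 0 0 1 0 + crd w 3 *: row4 0 0 0 1.
  by apply: crd_inj => -[|[|[|[|k]]]] // _; rewrite !crdD !crdZ !crd_row4; ring.
have D0 : 'D_(row4 1 0 0 0) (psi_a z rho) y = row4 1 0 0 0.
  apply: crd_inj => -[|[|[|[|k]]]] // _; rewrite crd_row4.
  - by rewrite (De _ _ id (crd y 0)) // => h; rewrite crd_row4 crdD crdZ crd_row4 mulr1.
  - by rewrite (De _ _ (cst (z (crd y 1) (crd y 2))) 0) // => h;
      rewrite crd_row4 !crdD !crdZ !crd_row4 !mulr0 !add0r.
  - by rewrite (De _ _ (cst (rho (crd y 1) (crd y 2))) 0) // => h;
      rewrite crd_row4 !crdD !crdZ !crd_row4 !mulr0 !add0r.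
  - by rewrite (De _ _ (cst (crd y 3)) 0) // => h;
      rewrite crd_row4 !crdD !crdZ !crd_row4 !mulr0 !add0r.
have D1 : 'D_(row4 0 1 0 0) (psi_a z rho) y =
    row4 0 (derive1 (z^~ (crd y 2)) (crd y 1)) (derive1 (rho^~ (crd y 2)) (crd y 1)) 0.
  apply: crd_inj => -[|[|[|[|k]]]] // _; rewrite crd_row4.
  - by rewrite (De _ _ (cst (crd y 0)) 0) // => h;
      rewrite crd_row4 !crdD !crdZ !crd_row4 !mulr0 !add0r.
  - by apply: De => h; rewrite crd_row4 !crdD !crdZ !crd_row4 !mulr0 !add0r mulr1.
  - by apply: De => h; rewrite crd_row4 !crdD !crdZ !crd_row4 !mulr0 !add0r mulr1.
  - by rewrite (De _ _ (cst (crd y 3)) 0) // => h;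
      rewrite crd_row4 !crdD !crdZ !crd_row4 !mulr0 !add0r.
have D2 : 'D_(row4 0 0 1 0) (psi_a z rho) y =
    row4 0 (derive1 (z (crd y 1)) (crd y 2)) (derive1 (rho (crd y 1)) (crd y 2)) 0.
  apply: crd_inj => -[|[|[|[|k]]]] // _; rewrite crd_row4.
  - by rewrite (De _ _ (cst (crd y 0)) 0) // => h;
      rewrite crd_row4 !crdD !crdZ !crd_row4 !mulr0 !add0r.
  - by apply: De => h; rewrite crd_row4 !crdD !crdZ !crd_row4 !mulr0 !add0r mulr1.
  - by apply: De => h; rewrite crd_row4 !crdD !crdZ !crd_row4 !mulr0 !add0r mulr1.
  - by rewrite (De _ _ (cst (crd y 3)) 0) // => h;
      rewrite crd_row4 !crdD !crdZ !crd_row4 !mulr0 !add0r.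
have D3 : 'D_(row4 0 0 0 1) (psi_a z rho) y = row4 0 0 0 1.
  apply: crd_inj => -[|[|[|[|k]]]] // _; rewrite crd_row4.
  - by rewrite (De _ _ (cst (crd y 0)) 0) // => h;
      rewrite crd_row4 !crdD !crdZ !crd_row4 !mulr0 !add0r.
  - by rewrite (De _ _ (cst (z (crd y 1) (crd y 2))) 0) // => h;
      rewrite crd_row4 !crdD !crdZ !crd_row4 !mulr0 !add0r.
  - by rewrite (De _ _ (cst (rho (crd y 1) (crd y 2))) 0) // => h;
      rewrite crd_row4 !crdD !crdZ !crd_row4 !mulr0 !add0r.
  - by rewrite (De _ _ id (crd y 3)) // => h; rewrite crd_row4 crdD crdZ crd_row4 mulr1.
have lin : 'D_w (psi_a z rho) y =
    crd w 0 *: 'D_(row4 1 0 0 0) (psi_a z rho) y + crd w 1 *: 'D_(row4 0 1 0 0) (psi_a z rho) y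
    + crd w 2 *: 'D_(row4 0 0 1 0) (psi_a z rho) y + crd w 3 *: 'D_(row4 0 0 0 1) (psi_a z rho) y.
  rewrite !(deriveE _ dp) [in LHS]split_w.
  by rewrite 3!linearD !linearZ.
rewrite lin D0 D1 D2 D3.
move: (derive1 (z^~ _) _) (derive1 (rho^~ _) _) => zr rr.
move: (derive1 (z _) _) (derive1 (rho _) _) => zt rt.
by apply: crd_inj => -[|[|[|[|k]]]] // _; rewrite !crdD !crdZ !crd_row4; ring.
Qed.

End SymmetricCoordinates.

(** * Local constancy of the squared Hubble rate *)

Section HubbleRate.
Context {R : realType}.
Implicit Types (a : R -> R) (o : 'rV[R]_3) (Q : 'M[R]_3) (x y u v w : 'rV[R]_4).

Lemma is_derive_rad a x u : differentiable a (crd x 0) ->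
  is_derive x u (fun y => crd y 1 * a (crd y 0))
    (crd u 1 * a (crd x 0) + crd x 1 * derive1 a (crd x 0) * crd u 0).
Proof.
move=> da.
have dA : is_derive x u (fun y => a (crd y 0)) (crd u 0 * derive1 a (crd x 0)).
  apply: (is_derive_comp_fun (crd_differentiable 0 x) (is_derive_crd_id 0 x u)).
  by rewrite derive1E; apply/derivableP/diff_derivable.
apply: (is_derive_eq (is_deriveM (is_derive_crd_id 1 x u) dA)).
rewrite /GRing.scale /=; ring.
Qed.

Lemma is_derive_rad_sin a x u : differentiable a (crd x 0) ->
  is_derive x u (fun y => crd y 1 * a (crd y 0) * sin (crd y 2))
    ((crd u 1 * a (crd x 0) + crd x 1 * derive1 a (crd x 0) * crd u 0) * sin (crd x 2)
     + crd x 1 * a (crd x 0) * cos (crd x 2) * crd u 2).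
Proof.
move=> da.
apply: (is_derive_eq (is_deriveM (is_derive_rad u da) (is_derive_sin_crd 2 x u))).
rewrite /GRing.scale /=; ring.
Qed.

Context (a : R -> R) (o : 'rV[R]_3) (T Rad : R -> R -> R).
Context (a_diff : forall t : R, 0 < t -> differentiable a t)
  (a_gt0 : forall t : R, 0 < t -> 0 < a t)
  (psi_s_natural : natural_spherical_change a o T Rad).

Let W' := [set x | polar_dom x /\ Mtilde a o (spherical o 1%:M x)].

Lemma psi_s_differentiable x : W' x -> differentiable (psi_s T Rad) x.
Proof.
by case: psi_s_natural => -[sp _] _ _ W'x; exact: smooth_on_differentiable sp W'x.
Qed.

Lemma near_spherical_dom x : W' x -> \forall y \near x, W' y.
Proof.
case: psi_s_natural => -[_ lp] _ _ /lp [B [g [oB BW _ _ _]]].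
by apply: filterS BW _; exact: open_nbhs_nbhs.
Qed.

(** Compare squared lengths of the theta direction: [Rad ^+ 2] in the spherical form and
    [(r * a) ^+ 2] in the FLRW metric. Both roots are nonnegative, so they agree. *)
Lemma natural_radius x : W' x -> Rad (crd x 0) (crd x 1) = crd x 1 * a (crd x 0).
Proof.
move=> W'x; have dp := psi_s_differentiable W'x.
have [[x0 x1 _] _] := W'x.
case: psi_s_natural => _ Rad0 /(_ _ W'x) [F [G /nbhs_singleton E]].
have Q1 : 1%:M *m (1%:M : 'M[R]_3)^T = 1%:M by rewrite trmx1 mulmx1.
have := inner_spherical a o x (row4 0 0 1 0) (row4 0 0 1 0) Q1.
rewrite -E inner_pullback.
rewrite -(deriveEjacobian _ dp).
have D0 : crd ('D_(row4 0 0 1 0) (psi_s T Rad) x) 0 = 0.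
  rewrite derive_crd; last exact: diff_derivable.
  by apply: crd_derive_const => h; rewrite !crd_row4 !crdD !crdZ !crd_row4 !mulr0 !add0r.
have D1 : crd ('D_(row4 0 0 1 0) (psi_s T Rad) x) 1 = 0.
  rewrite derive_crd; last exact: diff_derivable.
  by apply: crd_derive_const => h; rewrite !crd_row4 !crdD !crdZ !crd_row4 !mulr0 !add0r.
have [D2 D3] := derive_psi_s (row4 0 0 1 0) dp.
move: D0 D1 D2 D3; move: ('D_ _ _ _) => w D0 D1 D2 D3.
rewrite /strongly_spherical inner_diag sum4 -![w 0 _]/(crd w _).
rewrite -![row4 _ _ _ _ 0 _]/(crd (row4 _ _ _ _) _) D0 D1 D2 D3 !crd_row4.
have r0 : 0 <= Rad (crd x 0) (crd x 1) := ltW (Rad0 _ W'x).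
have r0' : 0 <= crd x 1 * a (crd x 0) := mulr_ge0 (ltW x1) (ltW (a_gt0 x0)).
rewrite !(mulr0, mul0r, add0r, addr0, mulr1) -exprMn [a _ * _]mulrC => /eqP.
by rewrite (eqrXn2 (ltn0Sn 1) r0 r0') => /eqP.
Qed.

Context (Q : 'M[R]_3) (W : set 'rV[R]_4) (z rho : R -> R -> R).
Context (QQ : Q *m Q^T = 1%:M)
  (Wdom : forall x, W x -> polar_dom x /\ Mtilde a o (spherical o Q x))
  (psi_a_natural : natural_axisymmetric_change a o T Rad Q W z rho).

Lemma axisymmetric_identity y : W y -> \forall x \near y,
  let r := crd x 1 * a (crd x 0) in
  derive1 (z r) (crd x 2) != 0 /\
  r * sin (crd x 2) * derive1 (z^~ (crd x 2)) r +
  cos (crd x 2) * Gcoef a (crd x 0) (crd x 1) * derive1 (z r) (crd x 2) = 0.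
Proof.
move=> Wy.
(* [psi_s] is natural with respect to the standard frame. Membership in [Mtilde] involves only t and
   r, so it does not change when [Q] is replaced by the identity. *)
have W'y : W' y.
  have [py] := Wdom Wy; split => //.
  apply/Mtilde_spherical; first by rewrite trmx1 mulmx1.
  exact/(Mtilde_spherical a o y QQ).
case: psi_a_natural => -[sa la] rho0 /(_ _ Wy) [A [B [C [D1 [D2 [D3 gE]]]]]].
have nW' := near_spherical_dom W'y.
have nB : \forall x \near y, (psi_s T Rad @` W) (psi_s T Rad x).
  have Wpy : (psi_s T Rad @` W) (psi_s T Rad y) by exists y.
  have [V [_ [oV VW _ _ _]]] := la _ Wpy.
  have : \forall x \near y, V (psi_s T Rad x).
    apply: (differentiable_continuous (psi_s_differentiable W'y)).
    exact: open_nbhs_nbhs.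
  by apply: filterS => x; exact: VW.
pose f := psi_a z rho \o psi_s T Rad.
have dpa x : (psi_s T Rad @` W) (psi_s T Rad x) ->
    differentiable (psi_a z rho) (psi_s T Rad x).
  exact: smooth_on_differentiable.
have Df x u : W' x -> (psi_s T Rad @` W) (psi_s T Rad x) ->
   u *m jacobian f x = row4 (crd ('D_u (psi_s T Rad) x) 0)
    (crd ('D_u (psi_s T Rad) x) 1 * derive1 (z^~ (crd x 2)) (crd x 1 * a (crd x 0))
       + crd u 2 * derive1 (z (crd x 1 * a (crd x 0))) (crd x 2))
    (crd ('D_u (psi_s T Rad) x) 1 * derive1 (rho^~ (crd x 2)) (crd x 1 * a (crd x 0))
       + crd u 2 * derive1 (rho (crd x 1 * a (crd x 0))) (crd x 2))
    (crd u 3).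
  move=> W'x Bx; have ds := psi_s_differentiable W'x; have da := dpa _ Bx.
  rewrite -(deriveEjacobian u (differentiable_comp ds da)) (derive_comp _ ds da).
  by rewrite (derive_psi_a _ da) !(derive_psi_s _ ds) !crd_row4 (natural_radius W'x).
have nrho : \forall x \near y, crd (f x) 2 = crd x 1 * a (crd x 0) * sin (crd x 2).
  near=> x.
  have W'x : W' x by near: x.
  have Bx : (psi_s T Rad @` W) (psi_s T Rad x) by near: x.
  have gx : pullback f (strongly_axisymmetric A B C D1 D2 D3) x =
        pullback (spherical o Q) (flrw a) x by near: x.
  have [[x0 x1 x2] _] := W'x.
  have := inner_spherical a o x (row4 0 0 0 1) (row4 0 0 0 1) QQ.
  rewrite -gx inner_pullback (Df _ _ W'x Bx).
  have -> : crd ('D_(row4 0 0 0 1) (psi_s T Rad) x) 0 = 0.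
    rewrite derive_crd; last exact/diff_derivable/psi_s_differentiable.
    by apply: crd_derive_const => h; rewrite !crd_row4 !crdD !crdZ !crd_row4 !mulr0 !add0r.
  have -> : crd ('D_(row4 0 0 0 1) (psi_s T Rad) x) 1 = 0.
    rewrite derive_crd; last exact/diff_derivable/psi_s_differentiable.
    by apply: crd_derive_const => h; rewrite !crd_row4 !crdD !crdZ !crd_row4 !mulr0 !add0r.
  rewrite inner_strongly_axisymmetric !crd_row4.
  have r0 : 0 <= rho (Rad (crd x 0) (crd x 1)) (crd x 2).
    by have := ltW (rho0 _ Bx); rewrite !crd_row4.
  have r0' : 0 <= crd x 1 * a (crd x 0) * sin (crd x 2).
    have s0 : 0 < sin (crd x 2) by exact: sin_gt0_pi.
    exact: mulr_ge0 (mulr_ge0 (ltW x1) (ltW (a_gt0 x0))) (ltW s0).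
  rewrite !(mulr0, mul0r, add0r, addr0, mulr1) -!exprMn mulrA [a _ * _]mulrC => /eqP.
  by rewrite (eqrXn2 (ltn0Sn 1) r0 r0') => /eqP.
(* The formula for [rho] is going to be differentiated at [x], so it must hold on a neighbourhood of
   [x] and not just at [x]. *)
have nnrho : \forall x \near y, \forall x' \near x,
    crd (f x') 2 = crd x' 1 * a (crd x' 0) * sin (crd x' 2).
  exact: (near_join nrho).
near=> x; set r := crd x 1 * a (crd x 0).
have W'x : W' x by near: x.
have Bx : (psi_s T Rad @` W) (psi_s T Rad x) by near: x.
have gx : pullback f (strongly_axisymmetric A B C D1 D2 D3) x =
      pullback (spherical o Q) (flrw a) x by near: x.
have rx : \forall x' \near x, crd (f x') 2 = crd x' 1 * a (crd x' 0) * sin (crd x' 2).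
  by near: x.
have Rx : \forall x' \near x, W' x' by exact: near_spherical_dom.
have [[x0 x1 x2] _] := W'x.
have [_ nz _] : [/\ 0 < crd x 0, crd x 1 ^+ 2 * derive1 a (crd x 0) ^+ 2 != 1 &
      crd x 1 ^+ 2 != 0].
  by have [_] := W'x; apply: (Mtilde_spherical a o x _).1; rewrite trmx1 mulmx1.
have ds := psi_s_differentiable W'x.
have df : differentiable f x := differentiable_comp ds (dpa _ Bx).
have Du1 u : crd ('D_u (psi_s T Rad) x) 1 =
    crd u 1 * a (crd x 0) + crd x 1 * derive1 a (crd x 0) * crd u 0.
  rewrite derive_crd; last exact: diff_derivable.
  have [_ <-] := is_derive_rad u (a_diff x0).
  apply: near_eq_derive; near=> x'.
  have W'x' : W' x' by near: x'.
  by rewrite crd_row4 (natural_radius W'x').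
have Du2 u : crd (u *m jacobian f x) 2 =
    (crd u 1 * a (crd x 0) + crd x 1 * derive1 a (crd x 0) * crd u 0) * sin (crd x 2)
     + crd x 1 * a (crd x 0) * cos (crd x 2) * crd u 2.
  rewrite -(deriveEjacobian u df) derive_crd; last exact: diff_derivable.
  have [_ <-] := is_derive_rad_sin u (a_diff x0).
  exact: near_eq_derive.
pose t0 := crd ('D_(row4 1 0 0 0) (psi_s T Rad) x) 0.
pose t1 := crd ('D_(row4 0 1 0 0) (psi_s T Rad) x) 0.
have t2 : crd ('D_(row4 0 0 1 0) (psi_s T Rad) x) 0 = 0.
  rewrite derive_crd; last exact: diff_derivable.
  by apply: crd_derive_const => h; rewrite !crd_row4 !crdD !crdZ !crd_row4 !mulr0 !add0r.
pose zR := derive1 (z^~ (crd x 2)) r; pose zt := derive1 (z r) (crd x 2).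
pose v0 := row4 1 0 0 0 *m jacobian f x; pose v1 := row4 0 1 0 0 *m jacobian f x.
pose v2 := row4 0 0 1 0 *m jacobian f x.
pose s := sin (crd x 2); pose c := cos (crd x 2); pose a1 := derive1 a (crd x 0).
have V0 : [/\ crd v0 0 = t0, crd v0 1 = crd x 1 * a1 * zR, crd v0 2 = crd x 1 * a1 * s
             & crd v0 3 = 0].
  split.
  - by rewrite /v0 (Df _ _ W'x Bx) crd_row4.
  - by rewrite /v0 (Df _ _ W'x Bx) crd_row4 Du1 !crd_row4 !mul0r addr0 add0r mulr1.
  - by rewrite /v0 Du2 !crd_row4 mulr0 addr0 mul0r add0r mulr1.
  - by rewrite /v0 (Df _ _ W'x Bx) !crd_row4.
have V1 : [/\ crd v1 0 = t1, crd v1 1 = a (crd x 0) * zR, crd v1 2 = a (crd x 0) * s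
             & crd v1 3 = 0].
  split.
  - by rewrite /v1 (Df _ _ W'x Bx) crd_row4.
  - by rewrite /v1 (Df _ _ W'x Bx) crd_row4 Du1 !crd_row4 mul0r addr0 mulr0 addr0 mul1r.
  - by rewrite /v1 Du2 !crd_row4 !mulr0 !addr0 mul1r.
  - by rewrite /v1 (Df _ _ W'x Bx) !crd_row4.
have V2 : [/\ crd v2 0 = 0, crd v2 1 = zt, crd v2 2 = crd x 1 * a (crd x 0) * c
             & crd v2 3 = 0].
  split.
  - by rewrite /v2 (Df _ _ W'x Bx) crd_row4.
  - by rewrite /v2 (Df _ _ W'x Bx) crd_row4 Du1 !crd_row4 mul0r mulr0 addr0 mul0r add0r mul1r.
  - by rewrite /v2 Du2 !crd_row4 mul0r mulr0 addr0 mul0r add0r mulr1.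
  - by rewrite /v2 (Df _ _ W'x Bx) !crd_row4.
have g u v := inner_spherical a o x u v QQ.
have E00 := g (row4 1 0 0 0) (row4 1 0 0 0); have E01 := g (row4 1 0 0 0) (row4 0 1 0 0).
have E11 := g (row4 0 1 0 0) (row4 0 1 0 0); have E12 := g (row4 0 1 0 0) (row4 0 0 1 0).
have E22 := g (row4 0 0 1 0) (row4 0 0 1 0).
move: E00 E01 E11 E12 E22; rewrite -gx !inner_pullback -/v0 -/v1 -/v2.
rewrite !inner_strongly_axisymmetric.
case: V0 => -> -> -> ->; case: V1 => -> -> -> ->; case: V2 => -> -> -> ->.
move: (A _ _ _) (B _ _ _) (C _ _ _) (D1 _ _ _) (D2 _ _ _) (D3 _ _ _).
have s0 : 0 < s by exact: sin_gt0_pi.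
have {}nz : 1 - crd x 1 ^+ 2 * a1 ^+ 2 != 0 by rewrite subr_eq0 eq_sym.
have ax0 := a_gt0 x0.
rewrite /Gcoef -/zR -/zt -/s -/c -/a1 !crd_row4 /r.
move: x1 ax0 s0 nz; move: (crd x 1) (a (crd x 0)) t0 t1 zR zt s c a1.
clear; move=> rx ax t0 t1 zR zt s c a1 r0 a0 s0 nz A B C D1 D2 D3.
rewrite !(mulr0, mul0r, add0r, addr0, mulr1) ?oppr0 ?(add0r, addr0).
move=> E00 E01 E11 E12 E22.
exact: (axisymmetric_elimination r0 a0 s0 nz E00 E01 E11 E12 E22).
Unshelve. all: by end_near. Qed.

Lemma hubble_rate_locally_constant y : W y -> cos (crd y 2) != 0 ->
  \forall t \near crd y 0,
    (derive1 a t / a t) ^+ 2 = (derive1 a (crd y 0) / a (crd y 0)) ^+ 2.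
Proof.
move=> Wy cy; have [[y0 y1 y2] _] := Wdom Wy.
(* R = r and theta are constant along p, hence so is G. *)
pose r := crd y 1 * a (crd y 0).
have r0 : 0 < r by rewrite mulr_gt0 // a_gt0.
pose p t := row4 t (r / a t) (crd y 2) (crd y 3).
have ay0 : a (crd y 0) != 0 by rewrite gt_eqF // a_gt0.
have py : p (crd y 0) = y by rewrite /p /r mulfK // row4_crd.
have cp : {for crd y 0, continuous p}.
  apply: differentiable_continuous; apply: differentiable_row; apply: forall4.
  - rewrite (_ : (fun _ => _) = id) //.
    by apply/funext => t; rewrite -[LHS]/(crd _ 0) crd_row4.
  - rewrite (_ : (fun _ => _) = cst r * (fun t => (a t)^-1)); last first.
      by apply/funext => t; rewrite -[LHS]/(crd _ 1) crd_row4.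
    apply: differentiableM; first exact: differentiable_cst.
    by apply: differentiableV => //; exact: a_diff.
  - rewrite (_ : (fun _ => _) = cst (crd y 2)); first exact: differentiable_cst.
    by apply/funext => t; rewrite -[LHS]/(crd _ 2) crd_row4.
  - rewrite (_ : (fun _ => _) = cst (crd y 3)); first exact: differentiable_cst.
    by apply/funext => t; rewrite -[LHS]/(crd _ 3) crd_row4.
pose zR := derive1 (z^~ (crd y 2)) r; pose zt := derive1 (z r) (crd y 2).
have H : \forall t \near crd y 0, zt != 0 /\
    r * sin (crd y 2) * zR + cos (crd y 2) * Gcoef a t (r / a t) * zt = 0.
  have npos : \forall t \near crd y 0, 0 < t.
    by apply: open_nbhs_nbhs; split; [exact: open_gt|].
  have := axisymmetric_identity Wy; rewrite -{1}py => /cp np.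
  near=> t; have t0 : 0 < t by near: t.
  have at0 : a t != 0 by rewrite gt_eqF // a_gt0.
  have : (fun x => let r := crd x 1 * a (crd x 0) in
  derive1 (z r) (crd x 2) != 0 /\
  r * sin (crd x 2) * derive1 (z^~ (crd x 2)) r +
  cos (crd x 2) * Gcoef a (crd x 0) (crd x 1) * derive1 (z r) (crd x 2) = 0) (p t) by near: t.
  by rewrite /= /p !crd_row4 divfK.
have [zt0 H0] := nbhs_singleton H.
have rr0 : r ^+ 2 != 0 by rewrite expf_neq0 // gt_eqF.
apply: filterS H => t [_ Ht].
have : Gcoef a t (r / a t) = Gcoef a (crd y 0) (r / a (crd y 0)).
  apply: (mulfI cy); apply: (mulIf zt0); apply: (addrI (r * sin (crd y 2) * zR)).
  by rewrite Ht H0.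
(* At radius [r / a t] the coefficient is the inverse of 1 - r^2 (a'/a)^2. Inversion is injective,
   its default value 0 at 0 included, so no further nonvanishing has to be checked. *)
rewrite /Gcoef => /invr_inj /addrI /oppr_inj.
rewrite !expr_div_n => h; apply: (mulfI rr0).
by rewrite -!mulrA ![_ * _^-1]mulrC !mulrA; move: h; rewrite -!mulrA ![_^-1 * _]mulrC !mulrA.
Unshelve. all: by end_near. Qed.

End HubbleRate.

(** * Timelike curves and the boundary of the extension *)

Section LorentzianForms.
Context {R : realType}.
Implicit Types (h : 'M[R]_4) (u v w : 'rV[R]_4).

Lemma innerZl h (b : R) u v : inner h (b *: u) v = b * inner h u v.
Proof. by rewrite /inner -!scalemxAl mxE. Qed.

(** For timelike vectors Cauchy-Schwarz makes the spatial part smaller in absolute value than the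
    product of the time components. So [m x y < 0] says that the time components have the same sign,
    a transitive relation. *)
Lemma minkowski_cone u v w :
  let m x y := - (crd x 0 * crd y 0) + (crd x 1 * crd y 1 + crd x 2 * crd y 2
                 + crd x 3 * crd y 3) in
  m u u < 0 -> m v v < 0 -> m w w < 0 -> m u w < 0 -> m v w < 0 -> m u v < 0.
Proof.
move=> m.
have CS (x1 x2 x3 y1 y2 y3 : R) : (x1 * y1 + x2 * y2 + x3 * y3) ^+ 2 <=
    (x1 ^+ 2 + x2 ^+ 2 + x3 ^+ 2) * (y1 ^+ 2 + y2 ^+ 2 + y3 ^+ 2).
  rewrite -subr_ge0 (_ : _ - _ = (x1 * y2 - x2 * y1) ^+ 2
    + (x1 * y3 - x3 * y1) ^+ 2 + (x2 * y3 - x3 * y2) ^+ 2); last by ring.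
  by rewrite !addr_ge0 // sqr_ge0.
have norm_lt x y : m x x < 0 -> m y y < 0 ->
    `|crd x 1 * crd y 1 + crd x 2 * crd y 2 + crd x 3 * crd y 3| < `|crd x 0 * crd y 0|.
  rewrite /m => xx yy.
  rewrite -(@ltr_pXn2r _ 2) ?nnegrE // !real_normK ?num_real //.
  apply: (le_lt_trans (CS _ _ _ _ _ _)); rewrite exprMn.
  by apply: ltr_pM; rewrite ?addr_ge0 ?sqr_ge0 //; rewrite !expr2; lra.
have same_sign x y : m x x < 0 -> m y y < 0 -> m x y < 0 -> 0 < crd x 0 * crd y 0.
  move=> xx yy; have := norm_lt _ _ xx yy; rewrite /m ltr_norml => /andP [h1 h2] h3.
  rewrite ltNge; apply/negP => h4; move: h1; rewrite ler0_norm // opprK; lra.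
move=> uu vv ww uw vw.
have := same_sign _ _ uu ww uw; have := same_sign _ _ vv ww vw => hv hu.
have huv : 0 < crd u 0 * crd v 0.
  have : 0 < (crd u 0 * crd v 0) * crd w 0 ^+ 2.
    rewrite (_ : _ * _ = (crd u 0 * crd w 0) * (crd v 0 * crd w 0)); last by ring.
    exact: mulr_gt0.
  have w0 : 0 < crd w 0 ^+ 2.
    by rewrite lt0r sqr_ge0 andbT; apply: contraTneq hu => /eqP;
       rewrite sqrf_eq0 => /eqP ->; rewrite mulr0 ltxx.
  by rewrite pmulr_lgt0.
have := norm_lt _ _ uu vv; rewrite /m (gtr0_norm huv) ltr_norml => /andP [_]; lra.
Qed.

Lemma inner_row4 (b0 b1 b2 b3 : R) u v :
  inner (diag_mx (row4 b0 b1 b2 b3)) u v =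
  b0 * crd u 0 * crd v 0 + b1 * crd u 1 * crd v 1 + b2 * crd u 2 * crd v 2
  + b3 * crd u 3 * crd v 3.
Proof.
rewrite inner_diag sum4 -![row4 _ _ _ _ 0 _]/(crd (row4 _ _ _ _) _).
by rewrite !crd_row4.
Qed.

Lemma lorentzian_cone h u v w : lorentzian h ->
  inner h u u < 0 -> inner h v v < 0 -> inner h w w < 0 ->
  inner h u w < 0 -> inner h v w < 0 -> inner h u v < 0.
Proof.
move=> [_ [P Pu Ph]].
have E x y : inner h x y = - (crd (x *m invmx P) 0 * crd (y *m invmx P) 0)
    + (crd (x *m invmx P) 1 * crd (y *m invmx P) 1
       + crd (x *m invmx P) 2 * crd (y *m invmx P) 2
       + crd (x *m invmx P) 3 * crd (y *m invmx P) 3).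
  rewrite -[in LHS](mulmxKV Pu x) -[in LHS](mulmxKV Pu y) -inner_mulmx Ph inner_row4.
  ring.
rewrite !E; exact: minkowski_cone.
Qed.

End LorentzianForms.

(** * Openness of the embedding and lifts of timelike curves *)

Section Embedding.
Context {R : realType} (a : R -> R) (N : C0_spacetime R) (iota : 'rV[R]_4 -> N).
Context (a_gt0 : forall t : R, 0 < t -> 0 < a t)
  (iota_embedding : isometric_embedding a iota).
Implicit Types (x u v w : 'rV[R]_4) (i j : chart N).

Lemma flrw_dom_open : open (@flrw_dom R).
Proof.
apply: (@open_comp _ _ (fun x : 'rV[R]_4 => crd x 0) [set t | 0 < t]).
  by move=> x _; exact: crd_continuous.
exact: open_gt.
Qed.

Lemma iota_continuous x : flrw_dom x -> {for x, continuous iota}.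
Proof. by case: iota_embedding => -[+ _] _ _ _ _; apply. Qed.

Lemma iota_inj x u : flrw_dom x -> flrw_dom u -> iota x = iota u -> x = u.
Proof. by case: iota_embedding => _ + _ _ _; apply. Qed.

Lemma coord_iota_differentiable i x : flrw_dom x -> dom i (iota x) ->
  differentiable (coord i \o iota) x.
Proof.
move=> x0 ix; case: iota_embedding => -[_ /(_ i) si] _ _ _ _.
exact: smooth_on_differentiable si _.
Qed.

Lemma coord_iota_isometric i x u v : flrw_dom x -> dom i (iota x) ->
  inner (metric i (iota x)) (u *m jacobian (coord i \o iota) x)
        (v *m jacobian (coord i \o iota) x) = inner (flrw a x) u v.
Proof.
move=> x0 ix; case: iota_embedding => _ _ _ /(_ x x0 i ix) <- _.
by rewrite inner_pullback.
Qed.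

(** Take determinants in the isometry condition: that of the FLRW metric is nonzero and has the
    determinant of the Jacobian as a factor. *)
Lemma coord_iota_unit i x : flrw_dom x -> dom i (iota x) ->
  jacobian (coord i \o iota) x \in unitmx.
Proof.
move=> x0 ix; case: iota_embedding => _ _ _ /(_ x x0 i ix) E _.
have : \det (flrw a x) != 0.
  rewrite /flrw det_diag prodf_seq_neq0; apply/allP => k _ /=.
  move: k; apply: forall4; rewrite -[row4 _ _ _ _ _ _]/(crd (row4 _ _ _ _) _) crd_row4;
   by rewrite ?oppr_eq0 ?oner_eq0 // expf_neq0 // gt_eqF // a_gt0.
rewrite -E /pullback !det_mulmx unitmxE unitfE.
by apply: contraNneq => ->; rewrite !mul0r.
Qed.

Lemma coord_inj i p q : dom i p -> dom i q -> coord i p = coord i q -> p = q.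
Proof. by move=> ip iq E; rewrite -(coordK ip) E coordK. Qed.

Lemma iota_image_nbhs (B : set 'rV[R]_4) x : open B -> B `<=` flrw_dom -> B x ->
  nbhs (iota x) (iota @` B).
Proof.
move=> oB Bdom Bx; have [i ix] := dom_cover (iota x).
pose W := B `&` iota @^-1` dom i.
have oW : open W.
  rewrite openE => y [By iy]; apply: filterI; first exact: open_nbhs_nbhs.
  apply: (iota_continuous (Bdom _ By)).
  by apply: open_nbhs_nbhs; split => //; exact: dom_open.
have : nbhs (coord i (iota x)) ((coord i \o iota) @` W).
  apply: (@image_nbhs _ _ W (coord i \o iota)) => //.
  - by move=> y [By iy]; apply: coord_iota_differentiable => //; exact: Bdom.
  - by move=> y [By iy]; apply: coord_iota_unit => //; exact: Bdom.
  - move=> y y' /set_mem [By iy] /set_mem [By' iy'] /= /(coord_inj iy iy').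
    by apply: iota_inj; exact: Bdom.
move=> /(coord_continuous ix) nc'.
have nc : nbhs (iota x) (coord i @^-1` ((coord i \o iota) @` W)) by exact: nc'.
have ni : nbhs (iota x) (dom i).
  by apply: open_nbhs_nbhs; split => //; exact: dom_open.
apply: (@filterS _ _ (nbhs_filter (iota x)) _ _ _ (@filterI _ _ (nbhs_filter (iota x)) _ _ nc ni)) => q [[y [By iy] /= E] iq].
by exists y => //; exact: coord_inj E.
Qed.

Lemma iota_image_open (B : set 'rV[R]_4) : open B -> B `<=` flrw_dom ->
  open (iota @` B).
Proof.
by move=> oB Bdom; rewrite openE => _ [x Bx <-]; exact: iota_image_nbhs.
Qed.

(** Since [iota] is open and injective, its inverse is continuous on the image. *)
Lemma lift_continuous (c : R -> N) (x : R -> 'rV[R]_4) (s : R) :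
  (\forall s' \near s, flrw_dom (x s') /\ iota (x s') = c s') ->
  {for s, continuous c} -> {for s, continuous x}.
Proof.
move=> nx cc; have [xs0 xs] := nbhs_singleton nx.
move=> B /= nB.
have [B' [[oB' B'x] B'B]] : exists B', open_nbhs (x s) B' /\ B' `<=` B.
  exists (interior B); split; last exact: interior_subset.
  by split; [exact: open_interior|].
have nc : nbhs (c s) (iota @` (B' `&` flrw_dom)).
  rewrite -xs; apply: iota_image_nbhs => //; first exact: openI oB' flrw_dom_open.
have nc' : nbhs s (c @^-1` (iota @` (B' `&` flrw_dom))) by exact: cc nc.
apply: (@filterS _ _ (nbhs_filter s) _ _ _ (@filterI _ _ (nbhs_filter s) _ _ nx nc')) => s' [[x0 xE] [y [B'y y0] yE]].
by rewrite /= (iota_inj x0 y0) //; [exact: B'B|rewrite xE yE].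
Qed.

(** The lifted velocity is [v *m invmx J], timelike by isometry. Both [v] and the image of d/dt lie
    in the cone of the time field, so [lorentzian_cone] makes their product negative, which means
    that the time component of the lift is positive. *)
Lemma lift_velocity i (c : R -> N) (x : R -> 'rV[R]_4) (s : R) v :
  (\forall s' \near s, flrw_dom (x s') /\ iota (x s') = c s') ->
  {for s, continuous c} -> dom i (c s) -> is_derive s 1 (coord i \o c) v ->
  future_timelike i (c s) v ->
  exists w, [/\ is_derive s 1 x w, 0 < crd w 0 & inner (flrw a (x s)) w w < 0].
Proof.
move=> nx cc ic dc [vv vt]; have [xs0 xs] := nbhs_singleton nx.
have cx := lift_continuous nx cc.
have ix : dom i (iota (x s)) by rewrite xs.
have Ju := coord_iota_unit xs0 ix; set J := jacobian _ _ in Ju.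
exists (v *m invmx J); have g := coord_iota_isometric _ _ xs0 ix.
have vJ : v *m invmx J *m J = v by rewrite mulmxKV.
have ww : inner (flrw a (x s)) (v *m invmx J) (v *m invmx J) < 0.
  by rewrite -g -/J vJ xs.
split => //.
  apply: (lift_derivable cx) => //; first exact: coord_iota_differentiable.
  apply: near_eq_is_derive dc; apply: filterS nx => s' [_ /= ->] //.
have [et et'] : future_timelike i (iota (x s)) (row4 1 0 0 0 *m J).
  by case: iota_embedding => _ _ _ _; apply.
have : inner (flrw a (x s)) (v *m invmx J) (row4 1 0 0 0) < 0.
  rewrite -g -/J vJ; apply: (lorentzian_cone _ _ et _ _ et').
  - exact: metric_lorentzian.
  - by rewrite xs.
  - exact: time_timelike.
  - by rewrite xs.
by rewrite /flrw inner_row4 !crd_row4 !mulr0 !addr0 mulr1 mulN1r oppr_lt0.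
Qed.

End Embedding.

(** * Exit times and straight timelike segments *)

Section Segments.
Context {R : realType}.

(** The exit time is the infimum of the failures. [P] fails there too, because otherwise openness
    would keep failures away from their infimum. *)
Lemma first_exit (P : R -> Prop) :
  (forall s, 0 <= s <= 1 -> P s -> \forall s' \near s, P s') ->
  P 0 -> ~ P 1 ->
  exists s, [/\ 0 < s, s <= 1, ~ P s & forall s', 0 <= s' < s -> P s'].
Proof.
move=> oP P0 P1; pose E := [set s | 0 <= s <= 1 /\ ~ P s].
have E1 : E 1 by split; rewrite ?ler01 ?lexx.
have lE : lbound E 0 by move=> s [/andP []].
have iE : has_inf E by split; [exists 1|exists 0].
have m0 : 0 <= inf E by apply: lb_le_inf lE; exists 1.
have m1 : inf E <= 1 by apply: ge_inf => //; exists 0.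
have Pl s' : 0 <= s' < inf E -> P s'.
  move=> /andP [s0 sm]; apply: contrapT => nP.
  have : inf E <= s'.
    apply: ge_inf; first by exists 0.
    by split => //; rewrite s0 (ltW (lt_le_trans sm m1)).
  by rewrite leNgt sm.
have nPm : ~ P (inf E).
  move=> Pm; have /nbhs_ballP [e /= e0 eP] := oP _ (introT andP (conj m0 m1)) Pm.
  have [s [s01 nPs] sm] := inf_adherent e0 iE.
  have ms : inf E <= s by apply: ge_inf; [exists 0|split].
  apply: nPs; apply: eP; rewrite /ball /= ltr_norml.
  by apply/andP; split; lra.
exists (inf E); split => //.
by rewrite lt_neqAle m0 andbT; apply/eqP => E0; apply: nPm; rewrite -E0.
Qed.

Lemma cvg_inner {I : Type} (F : set_system I) {FF : Filter F} (h : I -> 'M[R]_4)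
    (u v : I -> 'rV[R]_4) (h0 : 'M[R]_4) (u0 v0 : 'rV[R]_4) :
  h x @[x --> F] --> h0 -> u x @[x --> F] --> u0 -> v x @[x --> F] --> v0 ->
  inner (h x) (u x) (v x) @[x --> F] --> inner h0 u0 v0.
Proof.
move=> ch cu cv.
have entry m n (M : I -> 'M[R]_(m, n)) (M0 : 'M[R]_(m, n)) i j :
    M x @[x --> F] --> M0 -> M x i j @[x --> F] --> M0 i j.
  move=> cM; have := @matrix_normedtype.coord_continuous R m n i j M0.
  by move=> cM0; exact: (cvg_comp M (fun A : 'M[R]_(m, n) => A i j) cM cM0).
have E h' u' v' : inner h' u' v' =
    \sum_(j < 4) (\sum_(i < 4) u' 0 i * h' i j) * v' 0 j.
  by rewrite /inner mxE; apply: eq_bigr => j _; rewrite !mxE.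
rewrite E; under eq_fun do rewrite E.
apply: cvg_big => [|j _]; first exact: add_continuous.
apply: cvgM; last exact: entry.
apply: cvg_big => [|i _]; first exact: add_continuous.
by apply: cvgM; exact: entry.
Qed.

Context {N : C0_spacetime R}.
Implicit Types (i j : chart N) (p q : N) (z v : 'rV[R]_4).

Lemma coordVK i y : (coord i @` dom i) y -> dom i (coordV i y) /\ coord i (coordV i y) = y.
Proof. by move=> [p ip <-]; rewrite coordK. Qed.

Lemma coordV_continuous_at i y : (coord i @` dom i) y -> {for y, continuous (coordV i)}.
Proof. by move=> [p ip <-]; exact: coordV_continuous. Qed.

Lemma future_timelike_scale i p v (b : R) : 0 < b ->
  future_timelike i p v -> future_timelike i p (b *: v).
Proof.
move=> b0 [vv vt].
have E u : inner (metric i p) v (b *: u) = b * inner (metric i p) v u.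
  by rewrite /inner linearZ /= -scalemxAr mxE.
split; rewrite innerZl; first by rewrite E !pmulr_rlt0.
by rewrite pmulr_rlt0.
Qed.

Lemma future_timelike_transition i j p v : dom i p -> dom j p ->
  future_timelike i p v ->
  future_timelike j p (v *m jacobian (coord j \o coordV i) (coord i p)).
Proof.
move=> ip jp [vv vt]; have /= gE := metric_transition ip jp.
rewrite /future_timelike (time_transition ip jp) -!inner_mulmx -gE.
by split.
Qed.

(** The metric and the time field are continuous, so strict negativity of both products survives a
    joint perturbation of point and vector. This is the source of straight timelike segments. *)
Lemma future_cone_nbhs i p : dom i p -> exists2 e : R, 0 < e &
  forall y v, `|y - coord i p| < e -> `|v - time i p| < e ->
    (coord i @` dom i) y /\ future_timelike i (coordV i y) v.
Proof.
move=> ip; set q := coord i p; set T0 := time i p.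
have cy : coordV i yv.1 @[yv --> (q, T0)] --> p.
  have : coordV i y @[y --> q] --> coordV i q by exact: coordV_continuous.
  rewrite /q coordK // => cV; apply: cvg_comp cV; exact: cvg_fst.
have cg : metric i (coordV i yv.1) @[yv --> (q, T0)] --> metric i p.
  apply: cvg_comp cy _; exact: metric_continuous.
have ct : time i (coordV i yv.1) @[yv --> (q, T0)] --> time i p.
  apply: cvg_comp cy _; exact: time_continuous.
have cv : yv.2 @[yv --> (q, T0)] --> T0 by exact: cvg_snd.
have T0T0 : inner (metric i p) T0 T0 < 0 by exact: time_timelike.
have n1 := cvgr_lt _ (cvg_inner cg cv cv) _ T0T0.
have n2 := cvgr_lt _ (cvg_inner cg cv ct) _ T0T0.
have n3 : \forall yv \near (q, T0), (coord i @` dom i) yv.1.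
  have : nbhs q (coord i @` dom i).
    by apply: open_nbhs_nbhs; split; [exact: cod_open|exists p].
  by move=> nq; apply: (@cvg_fst _ _ (nbhs q) (nbhs T0)).
have /nbhs_ballP [e /= e0 he] : \forall yv \near (q, T0), (coord i @` dom i) yv.1 /\
    future_timelike i (coordV i yv.1) yv.2.
  near=> yv; split; first by near: yv.
  by split; [near: yv; exact: n1|near: yv; exact: n2].
exists e => // y v ye ve; apply: (he (y, v)).
split; rewrite /= -ball_normE /= distrC //.
Unshelve. all: by end_near. Qed.

End Segments.

(** * Segments crossing the boundary of the image *)

Section BoundarySegments.
Context {R : realType} (a : R -> R) (N : C0_spacetime R) (iota : 'rV[R]_4 -> N).
Context (a_gt0 : forall t : R, 0 < t -> 0 < a t)
  (iota_embedding : isometric_embedding a iota).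
Implicit Types (i j : chart N) (p q : N) (z v : 'rV[R]_4).

Let M := iota @` @flrw_dom R.

Lemma image_open : open M.
Proof. exact: (iota_image_open a_gt0 iota_embedding flrw_dom_open). Qed.

Lemma boundary_notin p : boundary M p -> ~ M p.
Proof. by move=> [_]; rewrite ((interior_id _).1 image_open). Qed.

Lemma closure_boundary p : closure M p -> ~ M p -> boundary M p.
Proof. by move=> cp nMp; split => // /interior_subset. Qed.

Definition timelike_line i z v (s : R) : Prop :=
  (coord i @` dom i) (z + s *: v) /\ future_timelike i (coordV i (z + s *: v)) v.

(* For p on the boundary and z slightly in the past of p, either z lies in M
   and p does not, or z does not lie in M and points of M near p do. *)
Lemma boundary_segment p : boundary M p -> exists i z v,
  (forall s, -1 < s < 2 -> timelike_line i z v s) /\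
  ((M (coordV i z) /\ ~ M (coordV i (z + v))) \/
   (~ M (coordV i z) /\ M (coordV i (z + v)))).
Proof.
move=> bp; have [i ip] := dom_cover p.
have [e e0 he] := future_cone_nbhs ip.
set q := coord i p in he *; set T0 := time i p in he *.
(* With [d *: T0] and [xi] of norm at most [e / 8] and with [|s|], [|s - 1|] at most 2, the segment
   stays within [e / 2] of [q]. The bound [d * e] on [xi] keeps the rescaled direction
   [T0 + d^-1 *: xi] within [e] of [T0]. *)
pose K := `|T0| + 1; have K0 : 0 < K by rewrite ltr_wpDl.
pose d := e / (8 * K); have d0 : 0 < d by rewrite divr_gt0 // mulr_gt0.
have dT : `|d *: T0| <= e / 8.
  rewrite normrZ gtr0_norm // /d.
  rewrite (_ : e / (8 * K) * `|T0| = e / 8 * (`|T0| / K)); last by field; rewrite gt_eqF.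
  by rewrite ger_pMr ?divr_gt0 // ler_pdivrMr // mul1r lerDl.
pose n := Num.min (e / 8) (d * e); have n0 : 0 < n by rewrite lt_min divr_gt0 //= mulr_gt0.
pose z := q - d *: T0.
have line xi s : `|xi| < n -> -1 < s < 2 -> timelike_line i z (d *: T0 + xi) s.
  move=> xin /andP [s1 s2].
  have vE : d *: T0 + xi = d *: (T0 + d^-1 *: xi).
    by rewrite scalerDr scalerA divff ?gt_eqF // scale1r.
  have := he (z + s *: (d *: T0 + xi)) (T0 + d^-1 *: xi).
  case.
  - have -> : z + s *: (d *: T0 + xi) - q = (s - 1) *: (d *: T0) + s *: xi.
      by rewrite /z scalerDr scalerBl scale1r; apply/rowP => k; rewrite !mxE; ring.
    apply: (le_lt_trans (ler_normD _ _)); rewrite (normrZ (s - 1)) (normrZ s).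
    have h1 : `|s - 1| <= 2 by rewrite ler_norml; apply/andP; split; lra.
    have h2 : `|s| <= 2 by rewrite ler_norml; apply/andP; split; lra.
    have h3 : `|xi| <= e / 8 by rewrite (le_trans (ltW xin)) // ge_min lexx.
    have : `|s - 1| * `|d *: T0| <= 2 * (e / 8) by apply: ler_pM.
    have : `|s| * `|xi| <= 2 * (e / 8) by apply: ler_pM.
    by lra.
  - rewrite addrC addKr normrZ normfV (gtr0_norm d0) mulrC ltr_pdivrMr // mulrC.
    by rewrite (lt_le_trans xin) // ge_min lexx orbT.
  move=> cy ft; split => //.
  by rewrite [X in future_timelike _ _ X]vE; exact: future_timelike_scale.
have [Mz|nMz] := pselect (M (coordV i z)).
  exists i, z, (d *: T0); split.
    by move=> s hs; rewrite -[d *: T0]addr0; apply: line; rewrite ?normr0.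
  by left; split => //; rewrite subrK coordK //; exact: boundary_notin.
have [q' [Mq' [iq' qq']]] : M `&` (dom i `&` [set q' | `|coord i q' - q| < n]) !=set0.
  case: bp => cp _; apply: cp; apply: filterI.
    by apply: open_nbhs_nbhs; split => //; exact: dom_open.
  have := coord_continuous ip; move=> /cvgrPdist_lt /(_ n n0).
  by apply: filterS => q' /=; rewrite distrC.
exists i, z, (d *: T0 + (coord i q' - q)); split; first by move=> s; exact: line.
right; split => //.
by rewrite /z addrA subrK addrC subrK coordK.
Qed.

Lemma line_continuous i z v (s : R) : (coord i @` dom i) (z + s *: v) ->
  {for s, continuous (fun s : R => coordV i (z + s *: v))}.
Proof.
move=> cs; apply: (@continuous_comp _ _ _ (fun s : R => z + s *: v) (coordV i)).
  apply: continuousD; first exact: cst_continuous.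
  exact: scalel_continuous.
exact: coordV_continuous_at.
Qed.

Lemma line_smooth_into i z v (B : set R) :
  (forall s, B s -> (coord i @` dom i) (z + s *: v)) ->
  smooth_into B (fun s : R => coordV i (z + s *: v)).
Proof.
move=> Bd; split=> [s /Bd|j]; first exact: line_continuous.
apply: (smooth_on_line (transition_smooth i j)) => s [/Bd Bs js].
have [is_ cs] := coordVK Bs.
by exists (coordV i (z + s *: v)).
Qed.

Lemma line_velocity i j z v s : (coord i @` dom i) (z + s *: v) ->
  dom j (coordV i (z + s *: v)) ->
  is_derive s 1 (coord j \o (fun s : R => coordV i (z + s *: v)))
    (v *m jacobian (coord j \o coordV i) (z + s *: v)).
Proof.
move=> cs js; have [is_ csE] := coordVK cs.
have dt : differentiable (coord j \o coordV i) (z + s *: v).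
  apply: (smooth_on_differentiable (transition_smooth i j)).
  by exists (coordV i (z + s *: v)).
by rewrite -(deriveEjacobian v dt); exact: is_derive_line dt.
Qed.

Lemma line_future_timelike i j z v s : timelike_line i z v s ->
  dom j (coordV i (z + s *: v)) ->
  future_timelike j (coordV i (z + s *: v))
    (v *m jacobian (coord j \o coordV i) (z + s *: v)).
Proof.
move=> [cs ft] js; have [is_ csE] := coordVK cs.
by have := future_timelike_transition is_ js ft; rewrite csE.
Qed.

(** The margin [-1 < s < 2] around the unit interval supplies the larger open interval that
    [ftc_piece] asks for. *)
Lemma line_future_curve i z v : (forall s, -1 < s < 2 -> timelike_line i z v s) ->
  future_timelike_curve (fun s : R => coordV i (z + s *: v)) 0 1.
Proof.
move=> line; apply: (@ftc_piece _ _ _ 0 1 1 (fun s : R => coordV i (z + s *: v))) => //.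
  apply: line_smooth_into => s /= hs; apply: (line _ _).1.
  by move: hs => /andP [h1 h2]; apply/andP; split; lra.
move=> s j /andP [s0 s1] js.
have ls : timelike_line i z v s by apply: line; apply/andP; split; lra.
have [_ E] := line_velocity ls.1 js.
by rewrite derive1E E; exact: line_future_timelike.
Qed.

(** The margin survives the reparametrisation: [b + s * r] is above [- r], hence above -1, and below
    [b + 2 * r], hence below 2. *)
Lemma line_shift i z v (b r : R) : 0 <= b -> 0 < r -> b + r <= 1 ->
  (forall s, -1 < s < 2 -> timelike_line i z v s) ->
  (forall s, -1 < s < 2 -> timelike_line i (z + b *: v) (r *: v) s).
Proof.
move=> b0 r0 br line s /andP [s1 s2].
have E : z + b *: v + s *: (r *: v) = z + (b + s * r) *: v.
  by rewrite scalerA scalerDl addrA.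
have [cs ft] : timelike_line i z v (b + s * r).
  by apply: line; apply/andP; split; nra.
rewrite /timelike_line E; split => //; exact: future_timelike_scale.
Qed.

Lemma segment_nbhs i z v s : timelike_line i z v s -> M (coordV i (z + s *: v)) ->
  \forall s' \near s, M (coordV i (z + s' *: v)).
Proof.
move=> [cs _] Ms.
have cc := line_continuous cs.
by apply: cc; apply: open_nbhs_nbhs; split => //; exact: image_open.
Qed.

(** A boundary point exists, since otherwise [M] would be open and closed in the connected [N]. Of
    the two cases of [boundary_segment], leaving [M] is excluded: the first exit would be a future
    boundary point. In the other case the segment is cut at the last parameter outside [M]. *)
Lemma past_boundary_segment :
  M !=set0 -> M <> setT -> ~ (exists p, future_boundary iota p) ->
  exists i z v, [/\ forall s, -1 < s < 2 -> timelike_line i z v s,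
    ~ M (coordV i z) &
    forall s, 0 < s <= 1 -> M (coordV i (z + s *: v))].
Proof.
move=> M0 MT nfb.
have [p bp] : exists p, boundary M p.
  apply: contrapT => nb; apply: MT.
  have cM : closed M.
    move=> p cp; apply: contrapT => nMp; apply: nb; exists p.
    exact: closure_boundary.
  have := @st_connected _ N M M0.
  by apply; [exists M; [exact: image_open|rewrite setTI]|exists M; [|rewrite setTI]].
have [i [z [v [line [[Mz nMv]|[nMz Mv]]]]]] := boundary_segment bp.
  have [] := @first_exit R (fun s => M (coordV i (z + s *: v))).
  - move=> s /andP [s0 s1]; apply: segment_nbhs; apply: line; apply/andP; split; lra.
  - by rewrite scale0r addr0.
  - by rewrite scale1r.
  move=> r [r0 r1 nMr Ml]; exfalso; apply: nfb.
  exists (coordV i (z + r *: v)).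
  pose gam (s : R) := coordV i (z + s *: (r *: v)).
  have rl : forall s, -1 < s < 2 -> timelike_line i z (r *: v) s.
    have := @line_shift i z v 0 r (lexx _) r0 _ line; rewrite scale0r addr0 add0r.
    exact.
  have Mg s : 0 <= s < 1 -> M (gam s).
    move=> /andP [s0 s1]; rewrite /gam scalerA; apply: Ml.
    by rewrite mulr_ge0 ?(ltW r0) //= gtr_pMl.
  split.
    apply: closure_boundary => // B nB.
    have c1 : {for (1 : R), continuous gam}.
      apply: line_continuous; apply: (rl _ _).1.
      by apply/andP; split; lra.
    have : nbhs (1 : R) (gam @^-1` B) by apply: c1; rewrite /gam scale1r.
    move=> /nbhs_ballP [e /= e0 eB].
    pose s := 1 - Num.min (e / 2) (1 / 2).
    have m0 : 0 < Num.min (e / 2) (1 / 2) by rewrite lt_min !divr_gt0.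
    have m1 : Num.min (e / 2) (1 / 2) <= 1 / 2 by rewrite ge_min lexx orbT.
    have m2 : Num.min (e / 2) (1 / 2) <= e / 2 by rewrite ge_min lexx.
    exists (gam s); split.
      by apply: Mg; rewrite /s; apply/andP; split; lra.
    apply: eB; rewrite /ball /= /s opprB addrC subrK gtr0_norm //; lra.
  exists gam; split => //; first exact: line_future_curve.
  by rewrite /gam scale1r.
(* The same exit argument with the segment run backwards from its endpoint in [M]. *)
have [] := @first_exit R (fun s => M (coordV i (z + (1 - s) *: v))).
- move=> s /andP [s0 s1] Ms.
  have /nbhs_ballP [e /= e0 he] : \forall s' \near 1 - s, M (coordV i (z + s' *: v)).
    by apply: segment_nbhs => //; apply: line; apply/andP; split; lra.
  apply/nbhs_ballP; exists e => //= s' ss'; apply: he; move: ss'.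
  by rewrite /ball /= (_ : 1 - s - (1 - s') = s' - s) 1?distrC //; ring.
- by rewrite subr0 scale1r.
- by rewrite subrr scale0r addr0.
move=> r [r0 r1 nMr Ml].
exists i, (z + (1 - r) *: v), (r *: v); split => //.
  by apply: line_shift line; rewrite ?subr_ge0 // subrK.
move=> s /andP [s0 s1].
rewrite (_ : _ + _ + _ = z + (1 - (r - s * r)) *: v).
  by apply: Ml; apply/andP; split; nra.
by apply/rowP => k; rewrite !mxE; ring.
Qed.

End BoundarySegments.

(** * The past end of a lifted timelike curve *)

Section PastLimit.
Context {R : realType}.

Lemma cvg_crd {I : Type} (F : set_system I) {FF : Filter F} (x : I -> 'rV[R]_4)
    (l : 'rV[R]_4) :
  (forall k, (k < 4)%N -> crd (x s) k @[s --> F] --> crd l k) ->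
  x s @[s --> F] --> l.
Proof.
move=> cx; apply/cvgrPdist_le => e e0.
have n k : (k < 4)%N -> \forall s \near F, `|crd l k - crd (x s) k| <= e.
  by move=> /cx /cvgrPdist_le; apply.
near=> s; apply: norm_le_entry; first exact: ltW.
move=> i j; rewrite (ord1 i) mxE [X in _ + X]mxE.
move: j; apply: forall4.
- by near: s; exact: n.
- by near: s; exact: n.
- by near: s; exact: n.
- by near: s; exact: n.
Unshelve. all: by end_near. Qed.

Lemma timelike_component (a : R -> R) (x w : 'rV[R]_4) (m : R) k :
  inner (flrw a x) w w < 0 -> 0 < crd w 0 -> 0 < m <= a (crd x 0) ->
  (0 < k < 4)%N -> `|crd w k| <= crd w 0 / m.
Proof.
rewrite /flrw inner_row4 => wt w0 /andP [m0 ma] hk.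
have h : (a (crd x 0) * crd w k) ^+ 2 <= crd w 0 ^+ 2.
  rewrite exprMn; move: hk wt; case: k => [|[|[|[|k]]]] // _ wt.
  - have := sqr_ge0 (a (crd x 0) * crd w 2); have := sqr_ge0 (a (crd x 0) * crd w 3).
    by rewrite !exprMn !expr2; move: wt; rewrite !expr2; lra.
  - have := sqr_ge0 (a (crd x 0) * crd w 1); have := sqr_ge0 (a (crd x 0) * crd w 3).
    by rewrite !exprMn !expr2; move: wt; rewrite !expr2; lra.
  - have := sqr_ge0 (a (crd x 0) * crd w 1); have := sqr_ge0 (a (crd x 0) * crd w 2).
    by rewrite !exprMn !expr2; move: wt; rewrite !expr2; lra.
have a0 : 0 < a (crd x 0) := lt_le_trans m0 ma.
rewrite ler_pdivlMr // mulrC.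
have : `|a (crd x 0) * crd w k| <= crd w 0.
  by rewrite -(@ler_pXn2r _ 2) ?nnegrE ?(ltW w0) // real_normK ?num_real.
rewrite normrM (gtr0_norm a0); apply: le_trans.
by rewrite ler_wpM2r.
Qed.

(* As t' > 0, the bound m |x'| <= t' on the speed makes x + t / m and - x + t / m
   monotone. *)
Lemma past_limit (a : R -> R) (x w : R -> 'rV[R]_4) (e : R) :
  (forall t : R, 0 < t -> 0 < a t) -> (forall t : R, 0 < t -> {for t, continuous a}) ->
  (forall s : R, 0 < s < 1 -> [/\ is_derive s 1 x (w s), 0 < crd (w s) 0 &
     inner (flrw a (x s)) (w s) (w s) < 0]) ->
  0 < e -> (forall s : R, 0 < s < 1 -> e <= crd (x s) 0) ->
  exists2 l, e <= crd l 0 & x s @[s --> 0^'+] --> l.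
Proof.
move=> a0 ca dx e0 xe.
(* Staying below the interior parameter 3/4 confines [t] to the compact interval from [e] to [b], on
   which [a] has a positive minimum [m]. *)
pose t (s : R) := crd (x s) 0; pose b := t (3 / 4).
have dk k (s : R) : 0 < s < 1 -> is_derive s 1 (fun s : R => crd (x s) k) (crd (w s) k).
  by move=> /dx [ds _ _]; exact: is_derive_crd.
have in34 (s : R) : s \in `]0, (3 / 4)[ -> 0 < s < 1.
  by rewrite in_itv /= => /andP [h1 h2]; apply/andP; split; lra.
have mono (f : R -> R) (df : R -> R) :
    (forall s : R, 0 < s < 1 -> is_derive s 1 f (df s)) ->
    (forall s : R, s \in `]0, (3 / 4)[ -> 0 <= df s) ->
    {in `]0, (3 / 4)[ &, {homo f : u v / u <= v}}.
  move=> df1 df0; apply: ger0_derive1_le_oo.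
  - by move=> s /in34/df1 [].
  - by move=> s hs; rewrite derive1E; have [_ ->] := df1 _ (in34 _ hs); exact: df0.
  - move=> s /set_mem hs; have [h _] := df1 _ (in34 _ hs); apply: differentiable_continuous.
    exact/derivable1_diffP.
have t_lt (s : R) : s \in `]0, (3 / 4)[ -> t s <= b.
  move=> hs; have h01 := in34 _ hs; move: hs; rewrite in_itv /= => /andP [s0 s34].
  have [|u||c] := @MVT R t (fun s : R => crd (w s) 0) s (3 / 4).
  - exact: s34.
  - rewrite in_itv /= => /andP [h1 h2]; apply: dk; apply/andP; split; lra.
  - apply: continuous_in_within => u; rewrite /= in_itv /= => /andP [h1 h2].
    have [|h _] := @dk 0 u; first by apply/andP; split; lra.
    by apply: differentiable_continuous; exact/derivable1_diffP.
  rewrite in_itv /= => /andP [h1 h2] E.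
  have [|_ wc _] := dx c; first by apply/andP; split; lra.
  by rewrite -subr_ge0 /b E mulr_ge0 ?(ltW wc) // subr_ge0 ltW.
have eb : e <= b by apply: xe; apply/andP; split; lra.
have [m m0 am] : exists2 m, 0 < m & forall u : R, e <= u <= b -> m <= a u.
  have [|c] := @EVT_min R a e b eb.
    apply: continuous_in_within => u; rewrite /= in_itv /= => /andP [h1 _].
    by apply: ca; exact: lt_le_trans h1.
  rewrite in_itv /= => /andP [c1 _] h; exists (a c).
    by apply: a0; exact: lt_le_trans c1.
  by move=> u hu; apply: h; rewrite in_itv.
have wk k (s : R) : (0 < k < 4)%N -> s \in `]0, (3 / 4)[ -> `|crd (w s) k| <= crd (w s) 0 / m.
  move=> hk hs; have [_ w0 ww] := dx _ (in34 _ hs).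
  apply: timelike_component ww w0 _ hk; rewrite m0 /= am //.
  by rewrite xe ?in34 //= t_lt.
have half_in : (1 / 2 : R) \in `]0, (3 / 4)[ by rewrite in_itv /=; apply/andP; split; lra.
have sub (s : R) : s \in `]0, (1 / 2)[ -> (s \in `]0, (3 / 4)[) /\ s <= 1 / 2.
  by rewrite !in_itv /= => /andP [h1 h2]; split; [apply/andP; split; lra|lra].
have lim_mono (f : R -> R) (c : R) : {in `]0, (3 / 4)[ &, {homo f : u v / u <= v}} ->
    (forall s : R, s \in `]0, (1 / 2)[ -> c <= f s) ->
    exists l : R, f s @[s --> 0^'+] --> l.
  move=> fm fc; eexists; apply: (@nondecreasing_at_right_cvgr R f 0 (BLeft (1 / 2))).
  - by rewrite bnd_simp; lra.
  - by move=> u v /sub [u34 _] /sub [v34 _]; exact: fm.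
  - by exists c => _ [s /= hs <-]; exact: fc.
have tm : {in `]0, (3 / 4)[ &, {homo t : u v / u <= v}}.
  apply: (mono t _ (dk 0)).
  by move=> s /in34/dx [_ /ltW].
have [lt clt] : exists l : R, t s @[s --> 0^'+] --> l.
  by apply: (lim_mono _ e) => // s /sub [/in34 hs _]; exact: xe.
have tcst (s : R) : is_derive s 1 (fun s : R => t s) (crd (w s) 0) ->
    is_derive s 1 (fun s : R => t s / m) (crd (w s) 0 / m).
  move=> h; rewrite (_ : (fun s : R => t s / m) = m^-1 \*: t); last first.
    by apply/funext => u; rewrite mulrC.
  by rewrite [_ / m]mulrC; exact: is_deriveZ.
have limk k : (0 < k < 4)%N -> exists l : R, crd (x s) k @[s --> 0^'+] --> l.
  move=> hk.
  have gm : {in `]0, (3 / 4)[ &, {homo (fun s : R => crd (x s) k + t s / m) : u v / u <= v}}.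
    have dg (s : R) : 0 < s < 1 -> is_derive s 1 (fun s : R => crd (x s) k + t s / m)
        (crd (w s) k + crd (w s) 0 / m).
      by move=> hs; exact: is_deriveD (dk k s hs) (tcst _ (dk 0 s hs)).
    apply: (mono _ _ dg).
    by move=> s /(wk _ _ hk); rewrite ler_norml => /andP []; lra.
  have hm : {in `]0, (3 / 4)[ &, {homo (fun s : R => - crd (x s) k + t s / m) : u v / u <= v}}.
    have dh (s : R) : 0 < s < 1 -> is_derive s 1 (fun s : R => - crd (x s) k + t s / m)
        (- crd (w s) k + crd (w s) 0 / m).
      move=> hs; exact: is_deriveD (is_deriveN (dk k s hs)) (tcst _ (dk 0 s hs)).
    apply: (mono _ _ dh).
    by move=> s /(wk _ _ hk); rewrite ler_norml => /andP []; lra.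
  have [lg clg] : exists l : R, crd (x s) k + t s / m @[s --> 0^'+] --> l.
    (* A lower bound for one monotone function comes from the other: [- crd (x s) k + t s / m] is at
       most its value at 1/2, and [t s / m] is nonnegative. *)
    apply: (lim_mono _ (- (- crd (x (1 / 2)) k + t (1 / 2) / m))) => // s /sub [hs h2].
    have := hm _ _ hs half_in h2 => /=.
    have : 0 <= t s / m.
      by rewrite divr_ge0 ?(ltW m0) // (le_trans (ltW e0)) // xe ?in34.
    lra.
  exists (lg - lt / m).
  have -> : (fun s : R => crd (x s) k) = (fun s : R => crd (x s) k + t s / m - t s / m).
    by apply/funext => s; rewrite addrK.
  by apply: cvgB => //; apply: cvgM => //; exact: cvg_cst.
have [l1 c1] := limk 1 isT; have [l2 c2] := limk 2 isT; have [l3 c3] := limk 3 isT.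
exists (row4 lt l1 l2 l3); rewrite ?crd_row4; last first.
  by apply: cvg_crd => -[|[|[|[|k]]]] // _; rewrite crd_row4.
rewrite -(cvg_lim _ clt) //; apply: limr_ge; first by apply/cvg_ex; exists lt.
near=> s; apply: xe; apply/andP; split; near: s; first exact: nbhs_right_gt.
exact: nbhs_right_lt.
Unshelve. all: by end_near. Qed.

Context (a : R -> R) (N : C0_spacetime R) (iota : 'rV[R]_4 -> N).
Context (a_gt0 : forall t : R, 0 < t -> 0 < a t)
  (a_continuous : forall t : R, 0 < t -> {for t, continuous a})
  (iota_embedding : isometric_embedding a iota).
Let M := iota @` @flrw_dom R.

Lemma past_boundary_times i (z v : 'rV[R]_4) :
  (forall s : R, -1 < s < 2 -> timelike_line i z v s) ->
  ~ M (coordV i z) ->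
  (forall s : R, 0 < s <= 1 -> M (coordV i (z + s *: v))) ->
  boundary M (coordV i z) /\
  forall V : set N, open_nbhs (coordV i z) V -> exists2 t0 : R, 0 < t0 &
    forall t, 0 < t < t0 -> exists x, [/\ flrw_dom x, crd x 0 = t & V (iota x)].
Proof.
move=> line nM0 Ms; pose c (s : R) := coordV i (z + s *: v).
have c0 : c 0 = coordV i z by rewrite /c scale0r addr0.
have cc (s : R) : -1 < s < 2 -> {for s, continuous c}.
  by move=> hs; apply: line_continuous; exact: (line s hs).1.
have cr : c s @[s --> 0^'+] --> coordV i z.
  rewrite -c0; apply: cvg_at_right_filter; apply: cc; apply/andP; split; lra.
(* Preimages are picked one parameter at a time; their regularity in [s] comes afterwards, from
   [lift_velocity]. *)
have [x xE] : exists x : R -> 'rV[R]_4, forall s : R, 0 < s <= 1 ->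
    flrw_dom (x s) /\ iota (x s) = c s.
  have [x xE] := @choice R 'rV[R]_4 (fun s y => 0 < s <= 1 ->
    flrw_dom y /\ iota y = c s) (ltac:(move=> s; have [/Ms [y y0 yE]|ns] := boolP (0 < s <= 1); [by exists y|by exists 0])).
  by exists x.
have nx (s : R) : 0 < s < 1 -> \forall s' \near s, flrw_dom (x s') /\ iota (x s') = c s'.
  move=> /andP [s0 s1].
  have h0 : \forall s' \near s, 0 < s' by apply: open_nbhs_nbhs; split; [exact: open_gt|].
  have h1 : \forall s' \near s, s' < 1 by apply: open_nbhs_nbhs; split; [exact: open_lt|].
  near=> s'; apply: xE; apply/andP; split; first by near: s'.
  by apply: ltW; near: s'.
have [w wE] : exists w : R -> 'rV[R]_4, forall s : R, 0 < s < 1 ->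
    [/\ is_derive s 1 x (w s), 0 < crd (w s) 0 & inner (flrw a (x s)) (w s) (w s) < 0].
  have ex_w (s : R) : exists w : 'rV[R]_4, 0 < s < 1 ->
      [/\ is_derive s 1 x w, 0 < crd w 0 & inner (flrw a (x s)) w w < 0].
    have [s01|ns] := boolP (0 < s < 1); last by exists 0.
    have ls : timelike_line i z v s.
      by apply: line; move: s01 => /andP [s0 s1]; apply/andP; split; lra.
    have [js _] := coordVK ls.1.
    have [w hw] : exists w, [/\ is_derive s 1 x w, 0 < crd w 0 &
        inner (flrw a (x s)) w w < 0].
      apply: (lift_velocity a_gt0 iota_embedding (nx s s01) _ js (line_velocity ls.1 js)).
        by apply: line_continuous; exact: ls.1.
      exact: line_future_timelike.
    by exists w.
  have [w wE] := choice ex_w; by exists w.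
(* If the time stayed above [e], the lift would have a limit in the domain. As [N] is Hausdorff,
   [iota] would send it to the starting point of the segment, which is not in [M]. *)
have small e : 0 < e -> exists2 s : R, 0 < s < 1 & crd (x s) 0 < e.
  move=> e0; apply: contrapT => nex.
  have xe (s : R) : 0 < s < 1 -> e <= crd (x s) 0.
    by move=> s01; rewrite leNgt; apply/negP => h; apply: nex; exists s.
  have [l el xl] := past_limit a_gt0 a_continuous wE e0 xe.
  have l0 : flrw_dom l by exact: lt_le_trans e0 el.
  apply: nM0; exists l => //.
  have il : iota (x s) @[s --> 0^'+] --> iota l.
    exact: (cvg_comp _ _ xl (iota_continuous iota_embedding l0)).
  have cl : c s @[s --> 0^'+] --> iota l.
    apply: cvg_trans il; apply: near_eq_cvg; near=> s.
    have [|_ //] := xE s; apply/andP; split; near: s; first exact: nbhs_right_gt.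
    by apply: nbhs_right_le.
  exact: (cvg_unique (@st_hausdorff _ N) cl cr).
have dt (s : R) : 0 < s < 1 -> is_derive s 1 (fun s : R => crd (x s) 0) (crd (w s) 0).
  by move=> /wE [h _ _]; exact: is_derive_crd.
have tc (s : R) : 0 < s < 1 -> {for s, continuous (fun s : R => crd (x s) 0)}.
  move=> /dt [h _]; apply: differentiable_continuous.
  exact/derivable1_diffP.
have t_lt (s s' : R) : 0 < s < 1 -> 0 < s' < 1 -> crd (x s) 0 < crd (x s') 0 -> s < s'.
  move=> s01 s'01; rewrite ltNge [s < s']ltNge; apply: contra => ss'.
  apply: (@ger0_derive1_le_oo R (fun s : R => crd (x s) 0) 0 1) => //.
  - by move=> u; rewrite in_itv /= => /dt [].
  - move=> u; rewrite in_itv /= => hu; rewrite derive1E; have [_ ->] := dt u hu.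
    by have [_ /ltW] := wE u hu.
  - by move=> u /set_mem; rewrite /= in_itv /=; exact: tc.
split.
  apply: closure_boundary => // B nB.
  have nc : \forall s \near (0 : R)^'+, B (c s) by exact: cr nB.
  have H : \forall s \near (0 : R)^'+, (M `&` B) (c s).
    near=> s; split; last by near: s.
    apply: Ms; apply/andP; split; near: s; first exact: nbhs_right_gt.
    by apply: nbhs_right_le.
  have [s hs] := @filter_ex _ (at_right (0 : R)) _ _ H.
  by exists (c s).
move=> V [oV Vz].
have [s1 s101 Vs1] : exists2 s1 : R, 0 < s1 < 1 & forall s, 0 < s <= s1 -> V (c s).
  have /nbhs_ballP [e /= e0 he] := cr _ (open_nbhs_nbhs (conj oV Vz)).
  have m1 : Num.min (e / 2) (1 / 2) <= 1 / 2 by rewrite ge_min lexx orbT.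
  have m2 : Num.min (e / 2) (1 / 2) <= e / 2 by rewrite ge_min lexx.
  exists (Num.min (e / 2) (1 / 2)).
    by rewrite lt_min !divr_gt0 //=; lra.
  move=> s /andP [s0 ss]; apply: he => //.
  rewrite /ball /= sub0r normrN gtr0_norm //; lra.
exists (crd (x s1) 0); first by apply: (xE _ _).1; move: s101 => /andP [h1 h2]; rewrite h1 ltW.
move=> t /andP [t0 t1].
have [s2 s201 s2t] := small t t0.
have s21 : s2 < s1 by apply: t_lt => //; exact: lt_trans t1.
have in01 (s : R) : s2 <= s <= s1 -> 0 < s < 1.
  by move: s101 s201 => /andP [_ h1] /andP [h2 _] /andP [h3 h4]; apply/andP; split; lra.
have [|||s] := @IVT R (fun s : R => crd (x s) 0) s2 s1 t.
- exact: ltW.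
- by apply: continuous_in_within => s; rewrite /= in_itv /= => /in01; exact: tc.
- by rewrite le_max ge_min (ltW s2t) (ltW t1) orbT.
rewrite in_itv /= => hs st; have /andP [s0 s1'] := in01 s hs.
exists (x s); have [|x0 xc] := xE s; first by rewrite s0 ltW.
split => //; rewrite xc; apply: Vs1; rewrite s0.
by move: hs => /andP [].
Unshelve. all: by end_near. Qed.

End PastLimit.

(** * Generic points of polar coordinates *)

Section GenericPoints.
Context {R : realType}.

(** In a slice chart coordinate 2 vanishes on [S], so a small move along it leaves [S] while staying
    in the open set [E]. *)
Lemma surface_interior (N : C0_spacetime R) (S E : set N) (q : N) :
  surface S -> open E -> E `<=` S -> ~ E q.
Proof.
move=> sS oE ES Eq; have [W [f [g [[oW ofW gf _ [cg _]] Wq fS]]]] := sS q (ES _ Eq).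
have fWq : (f @` W) (f q) by exists q.
have nE : nbhs (f q) (g @^-1` E).
  by apply: (cg _ fWq); rewrite gf //; exact: open_nbhs_nbhs.
have nW : nbhs (f q) (f @` W) by exact: open_nbhs_nbhs.
have /nbhs_ballP [e /= e0 he] := @filterI _ _ (nbhs_filter (f q)) _ _ nE nW.
pose y := f q + (e / 2) *: row4 0 0 1 0.
have [Eg [q' Wq' fq']] : (g @^-1` E `&` f @` W) y.
  apply: he; rewrite -ball_normE /= /y opprD addNKr normrN normrZ.
  rewrite (@le_lt_trans _ _ (`|e / 2| * 1)) //.
    apply: ler_wpM2l => //; apply: norm_le_entry => // i j.
    rewrite (ord1 i); move: j; apply: forall4;
      by rewrite -[row4 _ _ _ _ _ _]/(crd _ _) crd_row4 ?normr0 ?normr1.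
  by rewrite mulr1 gtr0_norm ?divr_gt0 //; lra.
move: Eg; rewrite /= -fq' gf // => /ES /(fS _ Wq') [+ _].
rewrite fq' /y crdD crdZ crd_row4; have [-> _] := (fS _ Wq).1 (ES _ Eq).
by rewrite add0r mulr1 => /eqP; rewrite mulf_eq0 (gt_eqF e0) invr_eq0 pnatr_eq0.
Qed.

(** On some interval from 0 to [d] neither sum vanishes and [X0 + h] keeps its sign. There
    [(X0 + h) ^+ 2] is injective in [h], so at most one of the candidates [d / 2] and [d / 3]
    violates the last condition. *)
Lemma generic_perturbation (X0 X1 X2 k e : R) : 0 < e ->
  exists h, [/\ 0 < h < e, X2 + h != 0, X0 + h != 0 &
                k * ((X0 + h) ^+ 2 + X1 ^+ 2) != 1].
Proof.
move=> e0.
have [d [d0 de dX2 dX0]] : exists d, [/\ 0 < d, d <= e,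
    forall h, 0 < h < d -> X2 + h != 0 &
    (forall h, 0 < h < d -> X0 + h < 0) \/ (forall h, 0 < h < d -> 0 < X0 + h)].
  have aux (X : R) : exists2 d : R, 0 < d &
      (forall h, 0 < h < d -> X + h < 0) \/ (forall h, 0 < h < d -> 0 < X + h).
    have [X_lt0|X_ge0] := ltP X 0.
      by exists (- X); rewrite ?oppr_gt0 //; left => h /andP [h1 h2]; lra.
    by exists 1 => //; right => h /andP [h1 h2]; lra.
  have [d2 d20 h2] := aux X2; have [d1 d10 h1] := aux X0.
  exists (Num.min e (Num.min d2 d1)); split.
  - by rewrite !lt_min e0 d20 d10.
  - by rewrite ge_min lexx.
  - move=> h /andP [h0]; rewrite !lt_min => /and3P [_ hd _].
    have hh : 0 < h < d2 by rewrite h0.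
    by case: h2 => /(_ h hh) hX; [rewrite lt_eqF|rewrite gt_eqF].
  - by case: h1 => h1; [left|right] => h /andP [h0]; rewrite !lt_min => /and3P [_ _ hd];
      apply: h1; rewrite h0.
have d2 : 0 < d / 2 < d by apply/andP; split; lra.
have d3 : 0 < d / 3 < d by apply/andP; split; lra.
have nz h : 0 < h < d -> X0 + h != 0.
  by move=> hh; case: dX0 => /(_ h hh) hX; [rewrite lt_eqF|rewrite gt_eqF].
have [k2|k2] := eqVneq (k * ((X0 + d / 2) ^+ 2 + X1 ^+ 2)) 1; last first.
  exists (d / 2); split; rewrite ?dX2 ?nz //.
  by move: d2 => /andP [-> h]; rewrite (lt_le_trans h).
exists (d / 3); split; rewrite ?dX2 ?nz //.
  by move: d3 => /andP [-> h]; rewrite (lt_le_trans h).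
apply/eqP => k3.
have : k * ((d / 2 - d / 3) * ((X0 + d / 2) + (X0 + d / 3))) = 0.
  rewrite (_ : _ * _ = k * ((X0 + d / 2) ^+ 2 + X1 ^+ 2)
    - k * ((X0 + d / 3) ^+ 2 + X1 ^+ 2)); last by ring.
  by rewrite k2 k3 subrr.
move=> /eqP; rewrite !mulf_eq0 => /or3P [/eqP k0|/eqP h|/eqP h].
- by move: k2; rewrite k0 mul0r => /eqP; rewrite eq_sym oner_eq0.
- by lra.
- by case: dX0 => hX; have := hX _ d2; have := hX _ d3; lra.
Qed.

Context (o : 'rV[R]_3) (Q : 'M[R]_3) (QQ : Q *m Q^T = 1%:M).
Implicit Types (a : R -> R) (x y : 'rV[R]_4).

(** For orthogonal [Q] these are Cartesian coordinates about [o] in the frame of the rows of [Q];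
    entry 2 is the one along the polar axis. *)
Definition frame_coords x : 'rV[R]_3 := (rsubmx (x : 'rV_(1 + 3)) - o) *m Q^T.

Lemma polar_angle (u v : R) : u ^+ 2 + v ^+ 2 = 1 ->
  exists phi : R, cos phi = u /\ sin phi = v.
Proof.
move=> uv; have u1 : -1 <= u <= 1.
  by rewrite -ler_norml -(@ler_pXn2r _ 2) ?nnegrE // expr1n real_normK ?num_real //;
     have := sqr_ge0 v; lra.
have su : sin (acos u) = `|v|.
  by rewrite sin_acos // -uv addrC addKr sqrtr_sqr.
have [v0|v0] := leP 0 v.
  by exists (acos u); rewrite acosK // su ger0_norm.
by exists (- acos u); rewrite cosN acosK // sinN su ltr0_norm // opprK.
Qed.

(** The two hypotheses put the point off the polar axis and off the equatorial plane; the second is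
    what gives a nonzero cosine. The last clause records r sin theta, which decides membership in
    the exceptional set of [psi_a]. *)
Lemma polar_coordinates x : 0 < crd x 0 ->
  let X := frame_coords x in
  X 0 (inord 0) ^+ 2 + X 0 (inord 1) ^+ 2 != 0 -> X 0 (inord 2) != 0 ->
  exists y, [/\ polar_dom y, spherical o Q y = x, crd y 0 = crd x 0,
    cos (crd y 2) != 0 &
    (crd y 1 * sin (crd y 2)) ^+ 2 = X 0 (inord 0) ^+ 2 + X 0 (inord 1) ^+ 2].
Proof.
move=> x0 X; set X0 := X 0 (inord 0); set X1 := X 0 (inord 1); set X2 := X 0 (inord 2).
move=> rho0 X20.
have rho_gt0 : 0 < X0 ^+ 2 + X1 ^+ 2 by rewrite lt0r rho0 addr_ge0 ?sqr_ge0.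
pose r := Num.sqrt (X0 ^+ 2 + X1 ^+ 2 + X2 ^+ 2).
pose rho := Num.sqrt (X0 ^+ 2 + X1 ^+ 2).
have rho_gt : 0 < rho by rewrite sqrtr_gt0.
have rhoE : rho ^+ 2 = X0 ^+ 2 + X1 ^+ 2 by rewrite sqr_sqrtr // ltW.
have r_gt : 0 < r by rewrite sqrtr_gt0 ltr_wpDr // sqr_ge0.
have rE : r ^+ 2 = rho ^+ 2 + X2 ^+ 2.
  by rewrite rhoE sqr_sqrtr // addr_ge0 ?sqr_ge0 // ltW.
have ur : -1 < X2 / r < 1.
  rewrite -ltr_norml normrM normfV (gtr0_norm r_gt) ltr_pdivrMr // mul1r.
  rewrite -(@ltr_pXn2r _ 2) ?nnegrE ?(ltW r_gt) // real_normK ?num_real //.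
  by rewrite rE ltrDr exprn_gt0.
have ur' : -1 <= X2 / r <= 1 by move: ur => /andP [h1 h2]; rewrite !ltW.
have ct : cos (acos (X2 / r)) = X2 / r by rewrite acosK.
have st : sin (acos (X2 / r)) = rho / r.
  rewrite sin_acos // (_ : 1 - _ = (rho / r) ^+ 2); last first.
    rewrite !expr_div_n (_ : rho ^+ 2 = r ^+ 2 - X2 ^+ 2); last by rewrite rE addrK.
    by field; rewrite gt_eqF.
  by rewrite sqrtr_sqr ger0_norm // divr_ge0 // ltW.
have [phi [cp sp]] : exists phi : R, cos phi = X0 / rho /\ sin phi = X1 / rho.
  apply: polar_angle; rewrite !expr_div_n -mulrDl -rhoE divff //.
  by rewrite expf_neq0 // gt_eqF.
have rn : r != 0 by rewrite gt_eqF.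
have rhon : rho != 0 by rewrite gt_eqF.
exists (row4 (crd x 0) r (acos (X2 / r)) phi); rewrite /polar_dom /= !crd_row4 ct st.
split => //.
- split => //; apply/andP; split.
    by apply: acos_gt0; move: ur => /andP [h1 ->]; rewrite ltW.
  by apply: acos_ltpi; move: ur => /andP [-> h1]; rewrite ltW.
- have QQ' : Q^T *m Q = 1%:M by exact: mulmx1C.
  have n3 : r *: unit_normal (acos (X2 / r)) phi = X.
    have e3 (Y Z : 'rV[R]_3) : Y 0 (inord 0) = Z 0 (inord 0) ->
        Y 0 (inord 1) = Z 0 (inord 1) -> Y 0 (inord 2) = Z 0 (inord 2) -> Y = Z.
      move=> h0 h1 h2; apply/rowP => -[[|[|[|k]]] lk] //.
      - by have -> : Ordinal lk = inord 0; first by apply/val_inj; rewrite /= inordK.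
      - by have -> : Ordinal lk = inord 1; first by apply/val_inj; rewrite /= inordK.
      - by have -> : Ordinal lk = inord 2; first by apply/val_inj; rewrite /= inordK.
    have sE k (Y : 'rV[R]_3) : (r *: Y) 0 k = r * Y 0 k by rewrite mxE.
    apply: e3; rewrite sE -[unit_normal _ _]/(row3 _ _ _) !row3E ?ct ?st ?cp ?sp.
    + by rewrite -/X0; field; rewrite rn rhon.
    + by rewrite -/X1; field; rewrite rn rhon.
    + by rewrite -/X2; field.
  rewrite /spherical !crd_row4 scalemxAl n3 /X /frame_coords -mulmxA QQ' mulmx1.
  rewrite addrC subrK.
  transitivity (row_mx (lsubmx (x : 'rV_(1 + 3))) (rsubmx (x : 'rV_(1 + 3)))); last exact: (@hsubmxK _ 1 1 3 x).
  have lE : lsubmx (x : 'rV_(1 + 3)) = (crd x 0)%:M.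
    apply/rowP => k; rewrite ord1 !mxE eqxx mulr1n /crd; congr (x 0 _).
    by rewrite lshift_inord0.
  by rewrite lE.
- by rewrite mulf_neq0 // invr_eq0.
- by rewrite mulrC divfK.
Qed.

End GenericPoints.

(** * Points away from the surface and the exceptional sets *)

Section GenericPolarPoint.
Context {R : realType} (a : R -> R) (N : C0_spacetime R) (iota : 'rV[R]_4 -> N).
Context (a_gt0 : forall t : R, 0 < t -> 0 < a t)
  (da_continuous : forall t : R, 0 < t -> {for t, continuous (derive1 a)})
  (iota_embedding : isometric_embedding a iota).
Context (o : 'rV[R]_3) (Q : 'M[R]_3) (QQ : Q *m Q^T = 1%:M).

(** Apart from avoiding [S], the conditions amount to [F] being nonzero. A perturbed point of [B]
    satisfies this, so by continuity of [F] such points form a nonempty open set, whose open image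
    cannot lie inside [S]. *)
Lemma generic_polar_point (S : set N) (B : set 'rV[R]_4) x :
  surface S -> open B -> B `<=` @flrw_dom R -> B x ->
  exists y, [/\ polar_dom y, B (spherical o Q y), ~ S (iota (spherical o Q y)),
    cos (crd y 2) != 0 &
    (crd y 1 * sin (crd y 2)) ^+ 2 * derive1 a (crd y 0) ^+ 2 != 1].
Proof.
move=> sS oB Bdom Bx.
(* Moving along [v] shifts the frame coordinates 0 and 2 at equal rate and leaves coordinate 1 and
   the time fixed, as in [generic_perturbation]. The factors of [F] below vanish on the equatorial
   plane, on the polar axis, and where r^2 sin^2 theta a'^2 = 1. *)
pose v : 'rV[R]_(1 + 3) := row_mx 0 (row3 1 0 1 *m Q).
pose X (y : 'rV[R]_4) k := frame_coords o Q y 0 k.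
pose P y := X y (inord 0) ^+ 2 + X y (inord 1) ^+ 2.
pose F y := X y (inord 2) * P y * (P y * derive1 a (crd y 0) ^+ 2 - 1).
have /nbhs_ballP [e /= e0 he] : nbhs x B by exact: open_nbhs_nbhs.
have [h [/andP [h0 hh] h2 hX0 h1]] := generic_perturbation (X x (inord 0))
  (X x (inord 1)) (X x (inord 2)) (derive1 a (crd x 0) ^+ 2)
  (divr_gt0 e0 (ltr_wpDl (normr_ge0 v) (@ltr01 R))).
pose x1 : 'rV[R]_4 := x + h *: v.
have x10 : crd x1 0 = crd x 0.
  rewrite /x1 crdD crdZ (_ : crd v 0 = 0) ?mulr0 ?addr0 //.
  rewrite /v (_ : 0 = 0%:M :> 'M[R]_1); last by rewrite raddf0.
  exact: crd_row_mx0.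
have Xx1 : frame_coords o Q x1 = frame_coords o Q x + h *: row3 1 0 1.
  have rv : rsubmx (x1 : 'rV_(1 + 3)) = rsubmx (x : 'rV_(1 + 3)) + h *: (row3 1 0 1 *m Q).
    rewrite -[row3 1 0 1 *m Q](row_mxKr (0 : 'M[R]_1)).
    by apply/rowP => k; rewrite !mxE.
  rewrite /frame_coords rv addrAC mulmxDl -scalemxAl -mulmxA QQ mulmx1.
  by [].
have XE k : X x1 k = X x k + h * row3 1 0 1 0 k.
  by rewrite /X Xx1 mxE [X in _ + X]mxE.
have Fx1 : F x1 != 0.
  rewrite /F /P !XE !row3E x10 mulr1 mulr0 addr0 !mulf_neq0 //.
    rewrite gt_eqF // ltr_pwDl ?sqr_ge0 // lt0r sqr_ge0 andbT expf_neq0 //.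
  by rewrite subr_eq0 mulrC.
have Bx1 : B x1.
  apply: he; rewrite -ball_normE /= /x1 opprD addNKr normrN normrZ gtr0_norm //.
  apply: (@le_lt_trans _ _ (h * (`|v| + 1))).
    by apply: ler_wpM2l; [exact: ltW|rewrite lerDl].
  by rewrite -ltr_pdivlMr // ltr_wpDl.
have cX k y : {for y, continuous (fun y => X y k)}.
  have cfc : {for y, continuous (frame_coords o Q)}.
    apply: (@continuous_comp _ _ _ (fun y : 'rV[R]_4 => rsubmx (y : 'rV_(1 + 3)) - o)
      (fun u : 'rV[R]_3 => u *m Q^T)); last exact: mulmxr_continuous.
    apply: continuousB; last exact: cst_continuous.
    apply: differentiable_continuous; apply: differentiable_row => j.
    rewrite (_ : (fun _ => _) = (fun y : 'rV[R]_4 => y 0 (rshift 1 j))).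
      exact: differentiable_coord.
    by apply/funext => u; rewrite mxE.
  exact: (@continuous_comp _ _ _ (frame_coords o Q) (fun u : 'rV[R]_3 => u 0 k) y cfc
    (@matrix_normedtype.coord_continuous R 1 3 0 k _)).
have cP y : {for y, continuous P}.
  by apply: continuousD; apply: continuousM; exact: cX.
have cF y : flrw_dom y -> {for y, continuous F}.
  move=> y0; have ca : {for y, continuous (fun y => derive1 a (crd y 0))}.
    apply: (@continuous_comp _ _ _ (fun y : 'rV[R]_4 => crd y 0) (derive1 a)).
      exact: crd_continuous.
    exact: da_continuous.
  apply: continuousM; first by apply: continuousM; [exact: cX|exact: cP].
  apply: continuousB; last exact: cst_continuous.
  by apply: continuousM; [exact: cP|apply: continuousM; exact: ca].
pose B' := B `&` [set y | F y != 0].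
have oB' : open B'.
  rewrite openE => y [By Fy]; apply: (@filterI _ _ (nbhs_filter y)).
    exact: open_nbhs_nbhs.
  have nF : nbhs (F y) [set u : R | u != 0].
    by apply: open_nbhs_nbhs; split => //; exact: open_neq.
  exact: (cF y (Bdom _ By) _ nF).
have B'dom : B' `<=` @flrw_dom R by move=> y [/Bdom].
have oI := iota_image_open a_gt0 iota_embedding oB' B'dom.
have [x2 [[Bx2 Fx2] nS]] : exists x2, B' x2 /\ ~ S (iota x2).
  apply: contrapT => nex.
  have sub : iota @` B' `<=` S.
    by move=> _ [y B'y <-]; apply: contrapT => nS; apply: nex; exists y.
  by apply: (surface_interior sS oI sub (q := iota x1)); exists x1.
move: Fx2; rewrite /= /F !mulf_eq0 !negb_or => /andP [/andP [X2n Pn] kn].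
have [y [py yE y0 cy yr]] := polar_coordinates QQ (Bdom _ Bx2) Pn X2n.
exists y; rewrite yE; split => //.
by rewrite yr y0; move: kn; rewrite subr_eq0.
Qed.

End GenericPolarPoint.

(** * Divergence of the Hubble rate *)

Section HubbleDivergence.
Context {R : realType}.

Lemma hubble_rate_derive (a : R -> R) :
  smooth_on [set t : R | 0 < t] a -> (forall t : R, 0 < t -> 0 < a t) ->
  exists D : R -> R, forall t : R, 0 < t ->
    is_derive t 1 (fun t => (derive1 a t / a t) ^+ 2) (D t) /\
    {for t, continuous D}.
Proof.
move=> sa a0.
have da1 : derive1 a = 'D_1 a by apply/funext => t; rewrite derive1E.
have s1 : smooth_on [set t : R | 0 < t] (derive1 a).
  by rewrite da1 => k; have [_] := sa k.+1; apply.
have dda1 : derive1 (derive1 a) = 'D_1 (derive1 a) by apply/funext => t; rewrite derive1E.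
have s2 : smooth_on [set t : R | 0 < t] (derive1 (derive1 a)).
  by rewrite dda1 => k; have [_] := s1 k.+1; apply.
exists (fun t => 2 * (derive1 a t / a t) *
  ((derive1 (derive1 a) t * a t - derive1 a t * derive1 a t) / a t ^+ 2)).
move=> t ht; have an : a t != 0 := lt0r_neq0 (a0 t ht).
have a2n : a t * a t != 0 by rewrite mulf_neq0.
have c0 := smooth_on_continuous sa ht; have c1 := smooth_on_continuous s1 ht.
have c2 := smooth_on_continuous s2 ht; split; last first.
  apply: continuousM.
    apply: continuousM; first exact: cst_continuous.
    by apply: continuousM; [exact: c1|apply: continuousV; [exact: an|exact: c0]].
  apply: continuousM.
    by apply: continuousB; apply: continuousM; [exact: c2|exact: c0|exact: c1|exact: c1].
  by apply: continuousV; [exact: a2n|apply: continuousM; exact: c0].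
have da : derivable a t 1 by apply: diff_derivable; exact: smooth_on_differentiable sa ht.
have dda : derivable (derive1 a) t 1.
  by apply: diff_derivable; exact: smooth_on_differentiable s1 ht.
have dV : is_derive t 1 (fun t => (a t)^-1) (- (a t) ^- 2 *: derive1 a t).
  apply: DeriveDef; first exact: (derivableV an da).
  by rewrite (deriveV an da) derive1E.
have -> : (fun t => (derive1 a t / a t) ^+ 2) = (derive1 a * (fun t => (a t)^-1)) ^+ 2.
  by apply/funext.
apply: (is_derive_eq (is_deriveX 2 (is_deriveM (derivableP dda) dV))).
rewrite -(derive1E (derive1 a)) /GRing.scale /= !fctE expr1.
move: (derive1 (derive1 a) t) (derive1 a t) (a t) an; clear => u v w w0.
by field.
Qed.

Lemma cvg_ereal_bounded_below (f : R -> R) (F : set_system R) {FF : Filter F}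
    (l : \bar R) :
  (0%:E < l)%E -> (f t)%:E @[t --> F] --> l ->
  exists2 c : R, 0 < c & \forall t \near F, c < f t.
Proof.
move=> l0 dl.
have [c c0 cl] : exists2 c : R, 0 < c & (c%:E < l)%E.
  case: l l0 {dl} => [r|_|//]; last by exists 1 => //; exact: ltry.
  by rewrite lte_fin => r0; exists (r / 2); [rewrite divr_gt0|rewrite lte_fin; lra].
exists c => //.
have nl : nbhs l [set u : \bar R | (c%:E < u)%E].
  by apply: open_nbhs_nbhs; split => //; exact: open_ereal_gt_ereal.
have nf : \forall t \near F, (c%:E < (f t)%:E)%E by exact: dl nl.
by near=> t; rewrite -lte_fin; near: t.
Unshelve. all: by end_near.
Qed.

(** The last hypothesis makes the derivative [D] of the rate vanish on a dense set of small times,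
    hence at all of them by continuity. The rate is then a single constant [k], although a'/a is
    unbounded near 0. *)
Lemma hubble_rate_contradiction (a : R -> R) (t0 : R) :
  smooth_on [set t : R | 0 < t] a -> (forall t : R, 0 < t -> 0 < a t) ->
  a t @[t --> 0^'+] --> (0 : R) ->
  (exists2 l : \bar R, (0%:E < l)%E & (derive1 a t)%:E @[t --> 0^'+] --> l) ->
  0 < t0 ->
  (forall t e : R, 0 < t < t0 -> 0 < e -> exists s : R, [/\ 0 < s, `|t - s| < e &
     \forall t' \near s, (derive1 a t' / a t') ^+ 2 = (derive1 a s / a s) ^+ 2]) ->
  False.
Proof.
move=> sa a0 al [l l0 dl] t00 dense.
have [D hD] := hubble_rate_derive sa a0.
have [c c0 dc] := cvg_ereal_bounded_below l0 dl.
clear sa l l0 dl.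
pose H (t : R) := (derive1 a t / a t) ^+ 2.
have dH (t : R) : 0 < t -> is_derive t 1 H (D t) by move=> /hD [].
have cD (t : R) : 0 < t -> {for t, continuous D} by move=> /hD [].
have D0 (t : R) : 0 < t < t0 -> D t = 0.
  move=> ht; have /andP [t_gt0 _] := ht.
  apply/eqP; apply: contrapT => /negP Dn.
  have : \forall s \near t, D s != 0.
    have nD : nbhs (D t) [set u : R | u != 0].
      by apply: open_nbhs_nbhs; split => //; exact: open_neq.
    exact: (cD t t_gt0 _ nD).
  move=> /nbhs_ballP [e /= e0 he].
  have [s [s0 ts sc]] := dense t e ht e0.
  have /eqP[] := he s ts.
  have [_ <-] := dH s s0.
  rewrite (near_eq_derive _ (g := cst (H s))) ?derive_cst //.
have Hcst (t s : R) : 0 < t -> t <= s -> s < t0 -> H t = H s.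
  move=> ht; rewrite le_eqVlt => /orP [/eqP -> //|ts st0].
  have [u||u] := @MVT R H D t s ts.
  - by rewrite in_itv /= => /andP [tu _]; apply: dH; exact: lt_trans tu.
  - apply: continuous_in_within => u; rewrite /= in_itv /= => /andP [tu _].
    have [h _] := dH u (lt_le_trans ht tu).
    by apply: differentiable_continuous; exact/derivable1_diffP.
  rewrite in_itv /= => /andP [tu us]; rewrite D0; last first.
    by rewrite (lt_trans ht tu) (lt_trans us st0).
  by rewrite mul0r => /eqP; rewrite subr_eq0 => /eqP.
pose k := H (t0 / 2).
have k0 : 0 <= k by exact: sqr_ge0.
(* Together with [c < derive1 a t] this makes a'/a larger than [k + 1], whose square exceeds [k]. *)
have na : \forall t \near (0 : R)^'+, a t < c / (k + 1).
  by apply: (cvgr_lt _ al); rewrite divr_gt0 // ltr_wpDl.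
have nt : \forall t \near (0 : R)^'+, 0 < t by exact: nbhs_right_gt.
have nt2 : \forall t \near (0 : R)^'+, t < t0 / 2.
  by apply: nbhs_right_lt; rewrite divr_gt0.
have : \forall t \near (0 : R)^'+, False.
  near=> t.
  have ht : 0 < t by near: t.
  have t2 : t < t0 / 2 by near: t.
  have ac : c < derive1 a t by near: t; exact: dc.
  have ak : a t < c / (k + 1) by near: t.
  have Hk : H t = k by apply: Hcst => //; [exact: ltW|lra].
  have : k + 1 < derive1 a t / a t.
    rewrite ltr_pdivlMr ?a0 //; apply: lt_trans ac.
    by rewrite mulrC -ltr_pdivlMr // ltr_wpDl.
  by move: Hk; rewrite /H expr2; nra.
by move=> /filter_ex [].
Unshelve. all: by end_near. Qed.

End HubbleDivergence.

(** With cos^2 + sin^2 = 1 the equation G = - tan^2 theta rearranges to r^2 sin^2 theta a'^2 = 1. If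
    the denominator of [Gcoef] vanishes, its value is 0 by default, which differs from - tan^2 theta
    because sin theta is positive. *)
Lemma Gcoef_neq {R : realType} (a : R -> R) (t r theta : R) :
  0 < theta < pi -> cos theta != 0 ->
  (r * sin theta) ^+ 2 * derive1 a t ^+ 2 != 1 ->
  Gcoef a t r <> - tan theta ^+ 2.
Proof.
move=> th c0 nz; have s0 : 0 < sin theta by exact: sin_gt0_pi.
rewrite /Gcoef /tan; have := cos2Dsin2 theta; move: nz.
move: (cos theta) (sin theta) (derive1 a t) c0 s0; clear => c s b c0 s0 nz cs E.
set u := 1 - r ^+ 2 * b ^+ 2 in E.
have [u0|u0] := eqVneq u 0.
  move: E; rewrite u0 invr0 => /esym/eqP; rewrite oppr_eq0 expf_eq0 /= mulf_eq0.
  by rewrite invr_eq0 (negbTE c0) (gt_eqF s0).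
case/negP: nz; apply/eqP.
have : c ^+ 2 = - s ^+ 2 * u.
  apply: (mulIf (invr_neq0 u0)); rewrite mulfK // E.
  by rewrite expr_div_n mulrN mulrCA divff ?mulr1 // expf_neq0.
by rewrite /u; lra.
Qed.

Theorem theorem1 (R : realType) (a : R -> R)
    (a_smooth : smooth_on [set t : R | 0 < t] a)
    (a_gt0 : forall t : R, 0 < t -> 0 < a t)
    (a_lim0 : a t @[t --> 0^'+] --> (0 : R))
    (a'_lim0 : exists2 l : \bar R, (0%:E < l)%E &
                 (derive1 a t)%:E @[t --> 0^'+] --> l)
    (inextendible : future_C0_inextendible a)
    (o : 'rV[R]_3) (T Rad : R -> R -> R)
    (psi_s_natural : natural_spherical_change a o T Rad) :
  ~ exists (N : C0_spacetime R) (iota : 'rV[R]_4 -> N),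
      natural_axisymmetric_extension a o T Rad iota.
Proof.
move=> [N [iota [[emb MT] ext]]].
have a_diff (t : R) : 0 < t -> differentiable a t.
  exact: smooth_on_differentiable a_smooth.
have a_cont (t : R) : 0 < t -> {for t, continuous a}.
  exact: smooth_on_continuous a_smooth.
have da_cont (t : R) : 0 < t -> {for t, continuous (derive1 a)}.
  have -> : derive1 a = 'D_1 a by apply/funext => u; rewrite derive1E.
  by have [_ /(_ 1 t)] := a_smooth 1.
have M0 : iota @` @flrw_dom R !=set0.
  exists (iota (row4 1 0 0 0)); exists (row4 1 0 0 0) => //.
  by rewrite /flrw_dom /= crd_row4.
have nfb : ~ exists p, future_boundary iota p.
  by move=> fb; apply: inextendible; exists N, iota.
have [i [z0 [v [line nMz Ms]]]] := past_boundary_segment a_gt0 emb M0 MT nfb.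
have [bp times] := past_boundary_times a_gt0 a_cont emb line nMz Ms.
have [V [S [oV _ sS [UM [psi_ext [psi_extV [_ _ _ [Q [z [rho [QQ psi_a_natural _]]]]]]]]]]] :=
  ext _ bp.
have [t0 t0_gt0 tV] := times V oV.
apply: (hubble_rate_contradiction a_smooth a_gt0 a_lim0 a'_lim0 t0_gt0) => t e tt0 e0.
have [x [x0 xt Vx]] := tV t tt0.
(* The generic point is sought in this open set, so that its image lies in [V] and its time is
   within [e] of [t]; this is the density asked for by [hubble_rate_contradiction]. *)
pose B := @flrw_dom R `&` ((iota @^-1` V) `&` [set y | `|t - crd y 0| < e]).
have oB : open B.
  rewrite openE => y [y0 [Vy ye]]; apply: (@filterI _ _ (nbhs_filter y)).
    by apply: open_nbhs_nbhs; split => //; exact: flrw_dom_open.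
  apply: (@filterI _ _ (nbhs_filter y)).
    apply: (iota_continuous emb y0); apply: open_nbhs_nbhs; split => //.
    by case: oV.
  have nt : nbhs (crd y 0) [set u | `|t - u| < e].
    apply/nbhs_ballP; exists (e - `|t - crd y 0|); first by rewrite /= subr_gt0.
    move=> u; rewrite /ball /= ltrBrDl; apply: le_lt_trans.
    exact: ler_distD.
  exact: (@crd_continuous R 0 y _ nt).
have Bx : B x by split => //; split => //=; rewrite xt subrr normr0.
have Bdom : B `<=` @flrw_dom R by move=> y [].
have [y [py [y0 [Vy ye]] nSy cy gy]] := generic_polar_point a_gt0 da_cont emb o QQ sS oB Bdom Bx.
rewrite /= spherical_crd0 in ye.
exists (crd y 0); split => //; first by case: py.
have Wdom : forall x, Utilde a o Q iota (V `\` S) x ->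
    polar_dom x /\ Mtilde a o (spherical o Q x).
  move=> x' [px' Ux' _]; split => //; apply: UM => //.
  by rewrite /flrw_dom /= spherical_crd0; case: px'.
apply: (hubble_rate_locally_constant a_diff a_gt0 psi_s_natural QQ Wdom psi_a_natural) => //.
split => //; apply: Gcoef_neq => //.
by case: py.
Qed.
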